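(* Let $P\in\mathbb C[z]$ be a nonconstant polynomial. Then the convolution operator $P(D)$, acting on $H(\mathbb C)$ endowed with the pointwise product, does not admit a closed hypercyclic algebra.
   Context: $H(\mathbb C)$ is the Fréchet algebra of entire functions with the topology of uniform convergence on compact sets and pointwise multiplication; $D:f\mapsto f'$, and for $P(z)=\sum_{s=0}^ta_sz^s$, $P(D)f=\sum_{s=0}^ta_sf^{(s)}$. $HC(T)$ is the set of vectors whose orbit $\{x,Tx,T^2x,\dots\}$ is dense. $T$ admits a closed hypercyclic algebra if $HC(T)\cup\{0\}$ contains a closed subalgebra different from $\{0\}$ (subalgebras are not required to be unital). *)

(* Defs.v *)
From mathcomp Require Import all_boot all_order all_algebra.
From mathcomp Require Import complex.
From mathcomp Require Import all_classical all_reals all_analysis.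

Set Implicit Arguments.
Unset Strict Implicit.
Unset Printing Implicit Defensive.

Import Order.TTheory GRing.Theory Num.Theory numFieldNormedType.Exports.

Local Open Scope classical_set_scope.
Local Open Scope ring_scope.
Local Open Scope complex_scope.

(* [R[i]^o] is the complex field seen as a normed space over itself, so that
   [derivable] and [derive1n] below are complex differentiation. *)

(* All maps from C to C, with uniform convergence on compact sets; the topology
   of H(C) is the one induced on the subset [entire]. *)
Notation CC R := {family compact, R[i]^o -> R[i]^o}.

Definition entire (R : realType) : set (CC R) :=
  [set f | forall z : R[i]^o, derivable (f : R[i]^o -> R[i]^o) z 1].

(* [derive1n] is a total operator, hence so is [P(D)]; it is of interest on
   [entire], where all the derivatives exist. *)
Definition poly_D (R : realType) (P : {poly R[i]}) (f : CC R) : CC R :=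
  fun z => \sum_(s < size P) P`_s * derive1n s (f : R[i]^o -> R[i]^o) z.

(* [X] is the underlying space, a subset of the topological space [E] with the
   induced topology; density of the orbit is density in [X]. *)
Definition HC (E : topologicalType) (X : set E) (T : E -> E) : set E :=
  [set x | X x /\ X `<=` closure (range (fun n => iter n T x))].

Definition closed_in (E : topologicalType) (X A : set E) : Prop :=
  exists F : set E, closed F /\ A = X `&` F.

(* Not necessarily unital. *)
Definition subalgebra (R : realType) (A : set (CC R)) : Prop :=
  [/\ A (fun=> 0),
      forall f g, A f -> A g -> A (fun z => f z + g z),
      forall (c : R[i]) f, A f -> A (fun z => c * f z) &
      forall f g, A f -> A g -> A (fun z => f z * g z)].

Definition admits_closed_hypercyclic_algebra (R : realType)
    (T : CC R -> CC R) : Prop :=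
  exists A : set (CC R),
    [/\ subalgebra A, closed_in (@entire R) A, A <> [set (fun=> 0)] &
        A `<=` HC (@entire R) T `|` [set (fun=> 0)]].

(* Main.v *)
Require Import Defs.
From mathcomp Require Import all_boot all_order all_algebra.
From mathcomp Require Import complex.
From mathcomp Require Import all_classical all_reals all_analysis.
From mathcomp Require Import ring lra.

(* If [f] is a non-constant element of a closed algebra, the algebra also contains
   [h = f * G (f)] for every entire [G]. Pick [z0] with [a := f z0] and [f' z0]
   nonzero, let [t] be the degree of [P] and expand
   [h = \sum_n b_n f (f - a)^(n t)]. Since [P(D)^n] has order [n t], only the
   terms up to the n-th contribute to [P(D)^n h z0], and the n-th one contributes
   [b_n] times a nonzero constant of size [(n t)!]. Hence the [b_n] can be chosen
   one after the other, so small that [G] is entire and yet such that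
   [P(D)^n h z0] has modulus at least 1 for all [n]; then 0 is not in the closure
   of the orbit of [h].

   That entire functions are infinitely differentiable is obtained from Goursat's
   theorem: every entire function has a primitive [F], and Cauchy's formula for
   [F] on the square with corners [±1 ± i] shows that [F] can be differentiated
   once more. *)

Set Implicit Arguments.
Unset Strict Implicit.
Unset Printing Implicit Defensive.

Import Order.TTheory GRing.Theory Num.Theory numFieldNormedType.Exports.
Import Normc.

Local Open Scope classical_set_scope.
Local Open Scope ring_scope.
Local Open Scope complex_scope.

Local Notation Re := complex.Re.
Local Notation Im := complex.Im.

(** * Derivatives relative to a set *)

(** The algebra need not contain the constants, so a series in [f] is available only after
    multiplication by [f]. This is why [h] carries the factor [f], and why [f z0] must not vanish:
    it is a factor of the n-th constant. Closedness serves to pass from polynomials in [f] to entire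
    functions of [f]. Stepping by [t] matches the order of [P(D)]: at [z0], one application uses up
    one factor [(f - a)^t]. As [(n t)!] is at least [n!], coefficients of the size of its inverse
    give an entire series, whatever choices were made before.

    Cauchy's formula is applied to the primitive [F] because [F] is already known to be twice
    differentiable. Its difference quotient at a point is then differentiable at that point too, and
    Goursat's theorem applies to it without a discussion of removable singularities. Integrals are
    increments of primitives along lines, and the value [2 pi i] is never computed: a nonzero
    normalization is enough. *)

(** Multiplying the difference quotient by [w - z] removes the division, and [w = z] is no longer an
    exception. The field is generic because both real and complex derivatives occur. *)
Lemma is_derive_dist_leP (K : numFieldType) (f : K^o -> K^o) (z d : K^o) :
  is_derive z (1 : K^o) f d <->
  forall e : K, 0 < e -> exists2 r : K, 0 < r &
    forall w : K, `|w - z| < r -> `|f w - f z - d * (w - z)| <= e * `|w - z|.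
Proof.
split=> [[df dfE] e e0|H].
  have /cvgrPdist_le/(_ e e0) := df; rewrite -/(derive f z 1) dfE.
  rewrite near_withinE => /nbhs_ballP[r /= r0 rP]; exists r => // w wz.
  have [->|wneq] := eqVneq w z; first by rewrite !subrr mulr0 subr0 normr0 mulr0.
  have wz0 : w - z != 0 by rewrite subr_eq0.
  have := rP (w - z); rewrite /ball /= sub0r normrN => /(_ wz wz0).
  rewrite [(w - z)%:A]mulr1 subrK => le_e.
  rewrite -ler_pdivrMr ?normr_gt0// -normfV -normrM (le_trans _ le_e)//.
  by rewrite distrC mulrBl mulfK // [X in X - d]mulrC.
have cv : (h^-1 *: ((f \o shift z) (h *: (1 : K^o)) - f z)) @[h --> 0^'] --> d.
  apply/cvgrPdist_le => e e0; have [r r0 rP] := H e e0.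
  rewrite near_withinE; apply/nbhs_ballP; exists r => //= h.
  rewrite /ball /= sub0r normrN => hr h0.
  have := rP (h + z); rewrite addrK => /(_ hr).
  rewrite -ler_pdivrMr ?normr_gt0// -normfV -normrM => /(le_trans _); apply.
  by rewrite distrC mulrBl mulfK // [X in X - d]mulrC [h%:A]mulr1.
by split; [apply/cvg_ex; exists d | apply: (cvg_lim _ cv) => //].
Qed.

(** * The modulus of a complex number as a real number *)

Section Modulus.
Context {R : realType}.
Implicit Types z w : R[i].

(** The norm of [R[i]] has its values in [R[i]]; a real-valued modulus gives access to real linear
    arithmetic. *)
Definition modC z : R := normc z.

Lemma normrC z : `|z| = (modC z)%:C. Proof. by rewrite normc_def; case: z. Qed.

Lemma modC_ge0 z : 0 <= modC z.
Proof. by rewrite -ler0c -normrC. Qed.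

Lemma modC0 : modC 0 = 0. Proof. exact: normc0. Qed.
Lemma modC1 : modC 1 = 1. Proof. exact: normc1. Qed.
Lemma modCM z w : modC (z * w) = modC z * modC w. Proof. exact: normcM. Qed.
Lemma modCV z : modC z^-1 = (modC z)^-1. Proof. exact: normcV. Qed.
Lemma modCN z : modC (- z) = modC z.
Proof. by apply: complexI; rewrite -!normrC normrN. Qed.
Lemma modCB z w : modC (z - w) = modC (w - z).
Proof. by rewrite -modCN opprB. Qed.
Lemma modCX z n : modC (z ^+ n) = modC z ^+ n.
Proof. by elim: n => [|n IH]; rewrite ?modC1// !exprS modCM IH. Qed.
Lemma modC_nat n : modC n%:R = n%:R.
Proof. by apply: complexI; rewrite -normrC normr_nat rmorph_nat. Qed.
Lemma ler_modCD z w : modC (z + w) <= modC z + modC w.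
Proof. exact: le_normcD. Qed.
Lemma ler_modCB z w : modC (z - w) <= modC z + modC w.
Proof. by rewrite -(modCN w); exact: ler_modCD. Qed.
Lemma modC_real (x : R) : modC x%:C = `|x|.
Proof. by rewrite /modC /= expr0n /= addr0 sqrtr_sqr. Qed.
Lemma modC_eq0 z : (modC z == 0) = (z == 0).
Proof. by apply/eqP/eqP => [/eq0_normc//|->]; rewrite modC0. Qed.
Lemma modC_gt0 z : (0 < modC z) = (z != 0).
Proof. by rewrite lt_def modC_ge0 modC_eq0 andbT. Qed.
Lemma modC_i : modC 'i = 1.
Proof. by rewrite /modC /= expr0n /= add0r expr1n sqrtr1. Qed.
Lemma sqr_modC z : modC z ^+ 2 = Re z ^+ 2 + Im z ^+ 2.
Proof. by case: z => a b; rewrite /modC /= sqr_sqrtr // addr_ge0 ?sqr_ge0. Qed.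
Lemma ler_Re_modC z : `|Re z| <= modC z.
Proof. by rewrite -lecR -normrC normc_ge_Re. Qed.
Lemma ler_Im_modC z : `|Im z| <= modC z.
Proof.
by rewrite -[leLHS]normrN -ReiNIm (le_trans (ler_Re_modC _))// modCM modC_i mulr1.
Qed.
Lemma ler_modC_ReIm z : modC z <= `|Re z| + `|Im z|.
Proof.
rewrite [in leLHS](complexE z) (le_trans (ler_modCD _ _))//.
by rewrite modCM modC_i mul1r !modC_real.
Qed.
Lemma modC_sum (I : Type) (r : seq I) (P : pred I) (F : I -> R[i]) :
  modC (\sum_(i <- r | P i) F i) <= \sum_(i <- r | P i) modC (F i).
Proof.
elim/big_ind2: _ => [|z a w b za wb|//]; first by rewrite modC0.
by rewrite (le_trans (ler_modCD _ _))// lerD.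
Qed.

End Modulus.

Arguments modC : simpl never.

(** * Calculus of relative derivatives *)

Section RelativeDerivative.
Context {R : realType}.
Implicit Types (S : set R[i]) (f g : R[i] -> R[i]) (z w d : R[i]).

(* [d] is the derivative of [f] at [z] relative to [S]. Taking for [S] a line
   gives primitives along lines; [S = setT] is complex differentiation. *)
Definition hasD S f z d := forall e : R, 0 < e -> exists2 r : R, 0 < r &
  forall w, S w -> modC (w - z) < r ->
    modC (f w - f z - d * (w - z)) <= e * modC (w - z).

Lemma hasD_sub S S' f z d : S' `<=` S -> hasD S f z d -> hasD S' f z d.
Proof.
by move=> sub H e e0; have [r r0 rP] := H e e0; exists r => // w /sub; exact: rP.
Qed.

Lemma hasD_eq S f g z d : (forall w, S w -> f w = g w) -> S z ->
  hasD S f z d -> hasD S g z d.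
Proof.
move=> fg Sz H e e0; have [r r0 rP] := H e e0; exists r => // w Sw.
by rewrite -!fg//; exact: rP.
Qed.

Lemma hasD_cst S c z : hasD S (fun=> c) z 0.
Proof.
move=> e e0; exists 1 => // w _ _; rewrite subrr mul0r subr0 modC0.
by rewrite mulr_ge0 ?modC_ge0 ?ltW.
Qed.

Lemma hasD_id S z : hasD S id z 1.
Proof.
move=> e e0; exists 1 => // w _ _; rewrite mul1r subrr modC0.
by rewrite mulr_ge0 ?modC_ge0 ?ltW.
Qed.

Lemma hasDD S f g z a b : hasD S f z a -> hasD S g z b ->
  hasD S (fun w => f w + g w) z (a + b).
Proof.
move=> fa gb e e0; have e2 : 0 < e / 2 by rewrite divr_gt0.
have [r r0 rP] := fa _ e2; have [s s0 sP] := gb _ e2.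
exists (Num.min r s); first by rewrite lt_min r0.
move=> w Sw; rewrite lt_min => /andP[/(rP w Sw) A /(sP w Sw) B].
have -> : f w + g w - (f z + g z) - (a + b) * (w - z) =
  (f w - f z - a * (w - z)) + (g w - g z - b * (w - z)) by ring.
rewrite (le_trans (ler_modCD _ _))// (le_trans (lerD A B))//.
by rewrite -mulrDl -splitr.
Qed.

Lemma hasDZ S f z c d : hasD S f z d -> hasD S (fun w => c * f w) z (c * d).
Proof.
move=> fd e e0; have c0 : 0 < modC c + 1 by rewrite ltr_wpDl ?modC_ge0.
have [r r0 rP] := fd (e / (modC c + 1)) (divr_gt0 e0 c0).
exists r => // w Sw /(rP w Sw) A.
have -> : c * f w - c * f z - c * d * (w - z) = c * (f w - f z - d * (w - z)) by ring.
rewrite modCM (le_trans (ler_wpM2l (modC_ge0 _) A))//.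
rewrite mulrA ler_wpM2r ?modC_ge0// mulrCA ger_pMr//.
by rewrite ler_pdivrMr// mul1r lerDl.
Qed.

Lemma hasDB S f g z a b : hasD S f z a -> hasD S g z b ->
  hasD S (fun w => f w - g w) z (a - b).
Proof.
move=> fa gb; have := hasDD fa (hasDZ (-1) gb); rewrite mulN1r.
by under eq_fun do rewrite mulN1r.
Qed.

Lemma hasD_lip S f z d : hasD S f z d ->
  exists2 r : R, 0 < r & forall w, S w -> modC (w - z) < r ->
    modC (f w - f z) <= (modC d + 1) * modC (w - z).
Proof.
move=> fd; have [r r0 rP] := fd 1 ltr01.
exists r => // w Sw /(rP w Sw) A.
have -> : f w - f z = d * (w - z) + (f w - f z - d * (w - z)) by ring.
by rewrite (le_trans (ler_modCD _ _))// modCM mulrDl lerD.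
Qed.

Lemma hasD_comp S S' f g z a b : (forall w, S w -> S' (g w)) ->
  hasD S g z b -> hasD S' f (g z) a -> hasD S (fun w => f (g w)) z (a * b).
Proof.
move=> SS' gb fa e e0.
have [r r0 rP] := hasD_lip gb.
set L := modC b + 1 in rP; have L0 : 0 < L by rewrite ltr_wpDl ?modC_ge0.
have A0 : 0 < modC a + 1 by rewrite ltr_wpDl ?modC_ge0.
have [s s0 sP] := fa (e / 2 / L) (divr_gt0 (divr_gt0 e0 (ltr0n _ 2)) L0).
have [u u0 uP] := gb (e / 2 / (modC a + 1)) (divr_gt0 (divr_gt0 e0 (ltr0n _ 2)) A0).
exists (Num.min (Num.min r u) (s / L)).
  by rewrite !lt_min r0 u0 divr_gt0.
move=> w Sw; rewrite !lt_min ltr_pdivlMr// => /andP[/andP[wr wu] ws].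
have lip := rP w Sw wr.
have := sP (g w) (SS' w Sw) (le_lt_trans lip _); rewrite mulrC => /(_ ws) B.
have C := uP w Sw wu.
have -> : f (g w) - f (g z) - a * b * (w - z) =
  (f (g w) - f (g z) - a * (g w - g z)) + a * (g w - g z - b * (w - z)) by ring.
rewrite (le_trans (ler_modCD _ _))// [leRHS](_ : _ = e / 2 * modC (w - z) + e / 2 * modC (w - z)); last by field.
apply: lerD.
  rewrite (le_trans B)// -mulrA ler_pM2l ?divr_gt0//.
  by rewrite mulrC ler_pdivrMr// mulrC.
rewrite modCM (le_trans (ler_wpM2l (modC_ge0 _) C))//.
rewrite mulrA ler_wpM2r ?modC_ge0// mulrCA ger_pMr ?divr_gt0//.
by rewrite ler_pdivrMr// mul1r lerDl.
Qed.

Lemma hasD_sqr S z : hasD S (fun w => w ^+ 2) z (2 * z).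
Proof.
move=> e e0; exists e => // w _ wz.
have -> : w ^+ 2 - z ^+ 2 - 2 * z * (w - z) = (w - z) * (w - z) by ring.
by rewrite modCM ler_wpM2r ?modC_ge0// ltW.
Qed.

(* Polarization: [4 f g = (f + g)^2 - (f - g)^2]. *)
Lemma hasDM S f g z a b : hasD S f z a -> hasD S g z b ->
  hasD S (fun w => f w * g w) z (a * g z + f z * b).
Proof.
move=> fa gb.
have sqr h c : hasD S h z c -> hasD S (fun w => h w ^+ 2) z (2 * h z * c).
  by move=> hc; exact: (@hasD_comp S setT (fun w => w ^+ 2)) hc (hasD_sqr _ _).
have := hasDZ 4^-1 (hasDB (sqr _ _ (hasDD fa gb)) (sqr _ _ (hasDB fa gb))).
have -> : 4^-1 * (2 * (f z + g z) * (a + b) - 2 * (f z - g z) * (a - b)) =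
  a * g z + f z * b by field.
by congr hasD; apply/funext => w; field.
Qed.

Lemma hasDP f z d : hasD setT f z d <-> is_derive (z : R[i]^o) (1 : R[i]^o)
  (f : R[i]^o -> R[i]^o) d.
Proof.
split=> [H|/is_derive_dist_leP H e e0].
  (* In the order of [R[i]], [0 < e] forces the imaginary part of [e] to be 0. *)
  apply/is_derive_dist_leP => -[e e']; rewrite ltcE /= => /andP[/eqP -> e0].
  have [r r0 rP] := H e e0; exists r%:C; first by rewrite ltcR.
  by move=> w; rewrite !normrC ltcR -(rmorphM (real_complex R)) lecR; exact: rP.
have := H e%:C; rewrite ltcR => /(_ e0) [[r r']]; rewrite ltcE /= => /andP[/eqP -> r0] rP.
exists r => // w _ wz; have := rP w.
by rewrite !normrC -(rmorphM (real_complex R)) lecR ltcR; exact.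
Qed.

Lemma hasDT_unique f z a b : hasD setT f z a -> hasD setT f z b -> a = b.
Proof.
by move=> /hasDP[_ <-] /hasDP[_ <-].
Qed.

Lemma hasD_loc S f g z d (r : R) : 0 < r -> S z ->
  (forall w, S w -> modC (w - z) < r -> f w = g w) -> hasD S f z d -> hasD S g z d.
Proof.
move=> r0 Sz fg H e e0; have [s s0 sP] := H e e0.
exists (Num.min r s); first by rewrite lt_min r0.
move=> w Sw; rewrite lt_min => /andP[wr ws].
by rewrite -!fg// ?subrr ?modC0//; exact: sP.
Qed.

Lemma hasD_shift f z c d : hasD setT f (z + c) d ->
  hasD setT (fun w => f (w + c)) z d.
Proof.
move=> fd; rewrite -[d]mulr1.
suff g1 : hasD setT (fun w => w + c) z 1 by exact: (hasD_comp (fun _ _ => Logic.I) g1 fd).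
by rewrite -[X in hasD _ _ _ X]addr0; apply: hasDD; [exact: hasD_id|exact: hasD_cst].
Qed.

Lemma hasDV S z : z != 0 -> hasD S (fun w => w^-1) z (- z^-1 ^+ 2).
Proof.
(* The first bound keeps [|w|] above [|z| / 2]; the second then comes from [|w z^2| > |z|^3 / 2]. *)
rewrite -modC_gt0 => z0 e e0; exists (Num.min (modC z / 2) (e * modC z ^+ 3 / 2)).
  by rewrite lt_min !divr_gt0// mulr_gt0// exprn_gt0.
move=> w _; rewrite lt_min => /andP[wz2 wze].
have w2 : modC z / 2 < modC w.
  have := ler_modCB w (w - z); rewrite subKr => ?.
  by lra.
have w0 : 0 < modC w by rewrite (lt_trans _ w2)// divr_gt0.
have -> : w^-1 - z^-1 - - z^-1 ^+ 2 * (w - z) = (w - z) * ((w - z) / (w * z ^+ 2)).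
  by field; rewrite -!modC_gt0 w0 z0.
rewrite modCM mulrC ler_wpM2r ?modC_ge0// modCM modCV modCM modCX.
rewrite ler_pdivrMr ?mulr_gt0 ?exprn_gt0// (le_trans (ltW wze))//.
have -> : e * modC z ^+ 3 / 2 = e * (modC z / 2 * modC z ^+ 2) by field.
by rewrite ler_pM2l// ler_pM2r ?exprn_gt0// ltW.
Qed.

Lemma hasD_continuous S f z d : hasD S f z d -> forall e, 0 < e ->
  exists2 r : R, 0 < r & forall w, S w -> modC (w - z) < r -> modC (f w - f z) < e.
Proof.
move=> /hasD_lip[r r0 rP] e e0.
have A0 : 0 < modC d + 1 by rewrite ltr_wpDl ?modC_ge0.
exists (Num.min r (e / (modC d + 1))); first by rewrite lt_min r0 divr_gt0.
move=> w Sw; rewrite lt_min ltr_pdivlMr// => /andP[wr we].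
by rewrite (le_lt_trans (rP _ Sw wr))// mulrC.
Qed.

End RelativeDerivative.

(** * Mean value inequality along a segment *)

Section MeanValue.
Context {R : realType}.
Implicit Types (f g : R[i] -> R[i]) (z w d p v : R[i]).

Definition lin p v : set R[i] := [set w | exists t : R, w = p + t%:C * v].

(** The mean value theorem is applied to the real part of [f] times the conjugate of
    [D = f b - f a], along the segment: the increment of this real function is [|D|^2], and dividing
    by [|D|] gives the bound. Only the derivative relative to the line enters, so that primitives
    along a single line are covered. *)
Lemma mean_value_le f f' a b (M : R) :
  (forall t : R, 0 <= t <= 1 -> let z := a + t%:C * (b - a) in
    hasD (lin a (b - a)) f z (f' z) /\ modC (f' z) <= M) ->
  modC (f b - f a) <= M * modC (b - a).
Proof.
move=> H; set D := f b - f a.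
pose z (t : R) := a + t%:C * (b - a).
have [D0|Dneq0] := eqVneq D 0.
  have [|_ M0] := H 0; first by rewrite lexx ler01.
  by rewrite D0 modC0 mulr_ge0 ?modC_ge0// (le_trans _ M0) ?modC_ge0.
pose g (t : R) : R := Re (D^*%C * f (z t)).
have dg (t : R) : t \in `[0, 1] ->
    is_derive (t : R) (1 : R) g (Re (D^*%C * f' (z t) * (b - a))).
  rewrite in_itv /= => /H[Hd _]; apply/is_derive_dist_leP => e e0.
  have L0 : 0 < modC D * modC (b - a) + 1.
    by rewrite ltr_wpDl// mulr_ge0 ?modC_ge0.
  have [r r0 rP] := Hd (e / (modC D * modC (b - a) + 1)) (divr_gt0 e0 L0).
  have B0 : 0 < modC (b - a) + 1 by rewrite ltr_wpDl ?modC_ge0.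
  exists (r / (modC (b - a) + 1)); first by rewrite divr_gt0.
  move=> s; rewrite ltr_pdivlMr// => st.
  have zst : z s - z t = (s - t)%:C * (b - a) by rewrite /z rmorphB /=; ring.
  have := rP (z s); rewrite -/(z t) => /(_ (ex_intro _ s erefl)).
  rewrite zst modCM modC_real => A.
  have B1 : modC (b - a) <= modC (b - a) + 1 by rewrite lerDl.
  have {}A := A (le_lt_trans (ler_wpM2l (normr_ge0 _) B1) st).
  have -> : g s - g t - Re (D^*%C * f' (z t) * (b - a)) * (s - t) =
     Re (D^*%C * (f (z s) - f (z t) - f' (z t) * ((s - t)%:C * (b - a)))).
    rewrite /g; case: (D^*%C) (f (z s)) (f (z t)) (f' (z t)) (b - a) => [? ?] [? ?] [? ?] [? ?] [? ?] /=; ring.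
  rewrite (le_trans (ler_Re_modC _))// modCM.
  have -> : modC D^*%C = modC D by apply: complexI; rewrite -!normrC normcJ.
  rewrite (le_trans (ler_wpM2l (modC_ge0 _) A))//.
  have -> : modC D * (e / (modC D * modC (b - a) + 1) * (`|s - t| * modC (b - a))) =
    e * `|s - t| * (modC D * modC (b - a) / (modC D * modC (b - a) + 1)).
    by field; rewrite gt_eqF.
  rewrite ler_piMr ?mulr_ge0 ?(ltW e0)//.
  by rewrite ler_pdivrMr// mul1r lerDl.
have cg : {within `[0, 1], continuous g}.
  by apply: derivable_within_continuous => t t01; have [] := dg t t01.
have dg' t : t \in `]0, 1[ -> is_derive (t : R) (1 : R) g (Re (D^*%C * f' (z t) * (b - a))).
  by move=> /subset_itv_oo_cc; exact: dg.
have [c c01] := MVT_segment ler01 dg' cg.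
have <- : modC D ^+ 2 = g 1 - g 0.
  rewrite sqr_modC /g /z rmorph1 rmorph0 mul1r mul0r addr0 [a + _]addrC subrK /D.
  by case: (f a) (f b) => [? ?] [? ?] /=; ring.
rewrite subr0 mulr1 => E.
have [_ le_M] := H c c01.
have D0 : 0 < modC D by rewrite modC_gt0.
rewrite -(ler_pM2l D0) -expr2 E (le_trans (ler_norm _))// (le_trans (ler_Re_modC _))//.
rewrite !modCM -mulrA.
have -> : modC D^*%C = modC D by apply: complexI; rewrite -!normrC normcJ.
by rewrite ler_pM2l// ler_wpM2r ?modC_ge0.
Qed.
End MeanValue.

(** * Primitives and Goursat's theorem *)

Section Primitives.
Context {R : realType}.

Lemma primitive_gt (f : R -> R) (a : R) : continuous f ->
  exists F : R -> R, forall x, a < x -> is_derive x (1 : R) F (f x).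
Proof.
move=> cf; exists (fun x : R => \int[lebesgue_measure]_(t in `[a, x]) f t) => x ax.
have xx1 : x < x + 1 by rewrite ltrDl.
have ifu : lebesgue_measure.-integrable `[a, x + 1] (EFin \o f).
  by apply: continuous_compact_integrable; [exact: segment_compact|exact: continuous_subspaceT].
have [dF F'] := continuous_FTC1_closed xx1 ifu ax (cf x).
by split=> //; rewrite -derive1E.
Qed.

Lemma is_derive_loc (F G : R -> R) (x l r : R) : 0 < r ->
  (forall y, `|y - x| < r -> F y = G y) ->
  is_derive x (1 : R) F l -> is_derive x (1 : R) G l.
Proof.
move=> r0 FG /is_derive_dist_leP H; apply/is_derive_dist_leP => e /H[s s0 sP].
exists (Num.min r s); first by rewrite lt_min r0.
move=> w; rewrite lt_min => /andP[wr ws].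
by rewrite -!FG ?subrr ?normr0//; exact: sP.
Qed.

(** The integral from a base point is a primitive only to the right of it. The left half line is
    reached through [x |-> f (- x)], and the two primitives differ by a constant on the overlap
    []-1, 1[]. *)
Lemma primitive_real (f : R -> R) : continuous f ->
  exists F : R -> R, forall x, is_derive x (1 : R) F (f x).
Proof.
move=> cf; have [A dA] := primitive_gt (-1) cf.
have cfN : continuous (fun x => f (- x)).
  by move=> x; apply: continuous_comp; [exact: opp_continuous|exact: cf].
have [B dB] := primitive_gt (-1) cfN.
pose B' x := - B (- x).
have dB' (x : R) : x < 1 -> is_derive x (1 : R) B' (f x).
  move=> x1; have /dB : -1 < - x by rewrite ltrN2.
  rewrite opprK => /is_derive_dist_leP H; apply/is_derive_dist_leP => e /H[r r0 rP].
  exists r => // w wx; have := rP (- w); rewrite -(opprD w (- x)) !normrN => /(_ wx).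
  have -> : B' w - B' x - f x * (w - x) = - (B (- w) - B (- x) - f x * - (w - x)).
    by rewrite /B'; ring.
  by rewrite normrN.
have AB (x : R) : -1 < x -> x < 1 -> A x - A 0 = B' x - B' 0.
  move=> x1 x2.
  pose d (y : R) := A y - B' y.
  have dd (y : R) : -1 < y -> y < 1 -> is_derive y (1 : R) d 0.
    move=> y1 y2; rewrite -(subrr (f y)).
    by apply: is_deriveB; [exact: dA|exact: dB'].
  suff : d x = d 0 by rewrite /d => /eqP; rewrite subr_eq => /eqP ->; ring.
  have E (u v : R) : -1 < u -> v < 1 -> u <= v -> d v = d u.
    move=> u1 v1 uv.
    have D (y : R) : y \in `[u, v] -> is_derive y (1 : R) d 0.
      rewrite in_itv /= => /andP[uy yv].
      by apply: dd; [exact: lt_le_trans uy|exact: le_lt_trans v1].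
    have D' (y : R) : y \in `]u, v[ -> is_derive y (1 : R) d 0.
      by move=> /subset_itv_oo_cc; exact: D.
    have [|c _] := MVT_segment uv D'.
      by apply: derivable_within_continuous => y /D[].
    by rewrite mul0r => /eqP; rewrite subr_eq0 => /eqP.
  have [x0|/ltW x0] := leP x 0.
    by rewrite -(E x 0)// ltr01.
  by rewrite (E 0 x)// ltrN10.
(* Within 1/2 of a point [x >= 0] only the first branch occurs; within 1/2 of a point [x < 0] the
   first branch occurs only on []-1/2, 1/2[], where both agree. *)
exists (fun x : R => if x > -(2^-1) then A x - A 0 else B' x - B' 0) => x.
have dAc (y : R) : -1 < y -> is_derive y (1 : R) (fun x => A x - A 0) (f y).
  by move=> y1; rewrite -[f y]subr0; apply: is_deriveB; exact: dA.
have dBc (y : R) : y < 1 -> is_derive y (1 : R) (fun x => B' x - B' 0) (f y).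
  by move=> y1; rewrite -[f y]subr0; apply: is_deriveB; exact: dB'.
have h0 : 0 < 2^-1 :> R by rewrite invr_gt0.
have [x0|x0] := ltP x 0.
  apply: (is_derive_loc h0 _ (dBc x _)); last by rewrite (lt_trans x0).
  move=> y; rewrite ltr_norml => /andP[y1 y2]; case: ifPn => // y3.
  by rewrite AB//; lra.
apply: (is_derive_loc h0 _ (dAc x _)); last by lra.
move=> y; rewrite ltr_norml => /andP[y1 y2].
by case: ifPn => //; rewrite -leNgt => y3; lra.
Qed.

Definition contC (S : set R[i]) (f : R[i] -> R[i]) :=
  forall z, S z -> forall e : R, 0 < e -> exists2 r : R, 0 < r &
    forall w, S w -> modC (w - z) < r -> modC (f w - f z) < e.

Lemma hasD_contC S f : (forall z, S z -> exists d, hasD S f z d) -> contC S f.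
Proof. by move=> df z /df[d /hasD_continuous]. Qed.

(** The parameter of a point of the line is recovered by [tau]. Real primitives [A], [B] of the two
    parts of [t |-> f (p + t v)] combine to [v (A + i B)], the factor [v] compensating the speed of
    the parametrization. *)
Lemma primitive_lin (f : R[i] -> R[i]) p v : v != 0 -> contC (lin p v) f ->
  exists G : R[i] -> R[i], forall z, lin p v z -> hasD (lin p v) G z (f z).
Proof.
move=> v0 cf.
have mv : 0 < modC v by rewrite modC_gt0.
have cpath (phi : R[i] -> R) : (forall z, `|phi z| <= modC z) ->
    (forall z w, phi (z - w) = phi z - phi w) ->
    continuous (fun t : R => phi (f (p + t%:C * v))).
  move=> phi_le phiB t; apply/cvgrPdist_lt => e /(cf (p + t%:C * v) (ex_intro _ t erefl))[r r0 rP].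
  apply/nbhs_ballP; exists (r / modC v); first by rewrite /= divr_gt0.
  move=> s; rewrite /ball /= ltr_pdivlMr// => st.
  rewrite distrC -phiB (le_lt_trans (phi_le _))// rP//; first by exists s.
  rewrite [X in modC X](_ : _ = (s - t)%:C * v).
    by rewrite modCM modC_real distrC.
  by rewrite rmorphB/=; ring.
have [|A dA] := primitive_real (cpath (@Re R) (@ler_Re_modC R) _).
  by case=> ? ? [].
have [|B dB] := primitive_real (cpath (@Im R) (@ler_Im_modC R) _).
  by case=> ? ? [].
pose tau w := Re ((w - p) / v).
have tauK t : tau (p + t%:C * v) = t by rewrite /tau addrAC subrr add0r mulfK.
exists (fun w => v * (A (tau w) +i* B (tau w))) => _ [t ->] e e0.
have e2 : 0 < e / 2 by rewrite divr_gt0.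
have /is_derive_dist_leP/(_ _ e2)[r r0 rP] := dA t.
have /is_derive_dist_leP/(_ _ e2)[s s0 sP] := dB t.
exists (Num.min r s * modC v); first by rewrite mulr_gt0// lt_min r0.
move=> _ [u ->]; rewrite !tauK.
have -> : p + u%:C * v - (p + t%:C * v) = (u - t)%:C * v by rewrite rmorphB/=; ring.
rewrite modCM modC_real ltr_pM2r// lt_min => /andP[/rP a /sP b].
set z := f _ in a b *.
have -> : v * (A u +i* B u) - v * (A t +i* B t) - z * ((u - t)%:C * v) =
   v * ((A u - A t - Re z * (u - t)) +i* (B u - B t - Im z * (u - t))).
  case: (v) (z) => [v1 v2] [z1 z2]; apply/eqP; rewrite eq_complex /=.
  by apply/andP; split; apply/eqP; ring.
rewrite modCM mulrC mulrA ler_pM2r// (le_trans (ler_modC_ReIm _))//=.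
by rewrite (le_trans (lerD a b))// -mulrDl -splitr.
Qed.

End Primitives.

(** * Integrals over rectangles, and primitives of entire functions *)

Section Goursat.
Context {R : realType}.
Implicit Types (f H V q : R[i] -> R[i]) (z w : R[i]) (x y : R).

Definition hor z : set R[i] := [set w | Im w = Im z].
Definition ver z : set R[i] := [set w | Re w = Re z].

Lemma mean_value_hor f f' x1 x2 y (M : R) :
  (forall x, `|x - x1| <= `|x2 - x1| -> `|x - x2| <= `|x2 - x1| ->
    hasD (hor (x +i* y)) f (x +i* y) (f' (x +i* y)) /\ modC (f' (x +i* y)) <= M) ->
  modC (f (x2 +i* y) - f (x1 +i* y)) <= M * `|x2 - x1|.
Proof.
move=> D; have d : x2 +i* y - x1 +i* y = (x2 - x1)%:C.
  by apply/eqP; rewrite eq_complex /= subrr !eqxx.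
rewrite -modC_real -d; apply: (@mean_value_le _ f f') => t /andP[t0 t1] /=.
have -> : x1 +i* y + t%:C * (x2 +i* y - x1 +i* y) = (x1 + t * (x2 - x1)) +i* y.
  by rewrite d; apply/eqP; rewrite eq_complex /=; apply/andP; split; apply/eqP; ring.
have [||D1 D2] := D (x1 + t * (x2 - x1)).
- by rewrite addrAC subrr add0r normrM ler_piMl// ger0_norm.
- rewrite (_ : _ - x2 = (t - 1) * (x2 - x1)); last by ring.
  by rewrite normrM ler_piMl// distrC ger0_norm; lra.
split=> //; apply: hasD_sub D1 => _ [u ->] /=.
rewrite d /hor /=; ring.
Qed.

Lemma mean_value_ver f f' x y1 y2 (M : R) :
  (forall y, `|y - y1| <= `|y2 - y1| -> `|y - y2| <= `|y2 - y1| ->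
    hasD (ver (x +i* y)) f (x +i* y) (f' (x +i* y)) /\ modC (f' (x +i* y)) <= M) ->
  modC (f (x +i* y2) - f (x +i* y1)) <= M * `|y2 - y1|.
Proof.
move=> D; have d : x +i* y2 - x +i* y1 = 'i * (y2 - y1)%:C.
  by apply/eqP; rewrite eq_complex /=; apply/andP; split; apply/eqP; ring.
have -> : `|y2 - y1| = modC (x +i* y2 - x +i* y1).
  by rewrite d modCM modC_i mul1r modC_real.
apply: (@mean_value_le _ f f') => t /andP[t0 t1] /=.
have -> : x +i* y1 + t%:C * (x +i* y2 - x +i* y1) = x +i* (y1 + t * (y2 - y1)).
  by rewrite d; apply/eqP; rewrite eq_complex /=; apply/andP; split; apply/eqP; ring.
have [||D1 D2] := D (y1 + t * (y2 - y1)).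
- by rewrite addrAC subrr add0r normrM ler_piMl// ger0_norm.
- rewrite (_ : _ - y2 = (t - 1) * (y2 - y1)); last by ring.
  by rewrite normrM ler_piMl// distrC ger0_norm; lra.
split=> //; apply: hasD_sub D1 => _ [u ->] /=.
by rewrite d /ver /=; ring.
Qed.

(** The primitives on distinct lines are chosen independently, so [H] has no regularity across
    lines; only its increments along one line are meaningful. *)
Lemma primitive_hor f : contC setT f ->
  exists H, forall z, hasD (hor z) H z (f z).
Proof.
move=> cf.
have /choice[G GP] (y : R) : exists g : R[i] -> R[i], forall z,
    lin ('i * y%:C) 1 z -> hasD (lin ('i * y%:C) 1) g z (f z).
  apply: primitive_lin; first exact: oner_neq0.
  by move=> z _ e e0; have [r r0 rP] := cf z Logic.I e e0; exists r => // w _; exact: rP.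
have hl z w : hor z w <-> lin ('i * (Im z)%:C) 1 w.
  case: z w => [x y] [x' y']; rewrite /hor /lin /=; split=> [->|[t]].
    exists x'; apply/eqP; rewrite eq_complex /=.
    by apply/andP; split; apply/eqP; ring.
  by case=> _ ->; ring.
exists (fun w => G (Im w) w) => z.
apply: (@hasD_eq _ _ (G (Im z))); [by move=> w -> | by [] | ].
by apply: hasD_sub (GP (Im z) z _) => [w /hl|]//; apply/hl.
Qed.

Lemma primitive_ver f : contC setT f ->
  exists V, forall z, hasD (ver z) V z (f z).
Proof.
move=> cf.
have i0 : 'i != 0 :> R[i] by rewrite -modC_eq0 modC_i oner_neq0.
have /choice[G GP] (x : R) : exists g : R[i] -> R[i], forall z,
    lin x%:C 'i z -> hasD (lin x%:C 'i) g z (f z).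
  apply: primitive_lin => // z _ e e0.
  by have [r r0 rP] := cf z Logic.I e e0; exists r => // w _; exact: rP.
have hl z w : ver z w <-> lin (Re z)%:C 'i w.
  case: z w => [x y] [x' y']; rewrite /ver /lin /=; split=> [->|[t]].
    exists y'; apply/eqP; rewrite eq_complex /=.
    by apply/andP; split; apply/eqP; ring.
  by case=> -> _; ring.
exists (fun w => G (Re w) w) => z.
apply: (@hasD_eq _ _ (G (Re z))); [by move=> w -> | by [] | ].
by apply: hasD_sub (GP (Re z) z _) => [w /hl|]//; apply/hl.
Qed.

(* The integral along the boundary of the rectangle with opposite corners
   [x1 + i y1] and [x2 + i y2], in terms of primitives on horizontal and
   vertical lines. *)
Definition rect_int H V x1 x2 y1 y2 : R[i] :=
  (H (x2 +i* y1) - H (x1 +i* y1)) + (V (x2 +i* y2) - V (x2 +i* y1))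
  - (H (x2 +i* y2) - H (x1 +i* y2)) - (V (x1 +i* y2) - V (x1 +i* y1)).

(** [q] is a primitive of the affine approximation of [f] at [p] and contributes nothing around the
    rectangle. The derivative of [H - q] and [V - q] is at most [e / 4 * s] there, [s] being half
    the perimeter, and each of the four sides has length at most [s]. *)
Lemma rect_int_small f H V p d (e : R) :
  (forall z, hasD (hor z) H z (f z)) -> (forall z, hasD (ver z) V z (f z)) ->
  hasD setT f p d -> 0 < e -> exists2 r : R, 0 < r &
  forall x1 x2 y1 y2, x1 <= Re p <= x2 -> y1 <= Im p <= y2 ->
    x2 - x1 + (y2 - y1) < r ->
    modC (rect_int H V x1 x2 y1 y2) <= e * (x2 - x1 + (y2 - y1)) ^+ 2.
Proof.
move=> dH dV fp e0; have e4 : 0 < e / 4 by rewrite divr_gt0.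
have [r r0 rP] := fp _ e4; exists r => // x1 x2 y1 y2 /andP[x1p px2] /andP[y1p py2].
set s := x2 - x1 + (y2 - y1) => sr.
pose q z := f p * z + (d / 2) * (z - p) ^+ 2.
have dq S z : hasD S q z (f p + d * (z - p)).
  have dl : hasD S (fun w => w - p) z (1 - 0) by apply: hasDB; [exact: hasD_id|exact: hasD_cst].
  have := hasDD (hasDZ (f p) (hasD_id S z)) (hasDZ (d / 2) (hasDM dl dl)).
  by congr hasD; last by field.
have near x y : x1 <= x <= x2 -> y1 <= y <= y2 ->
    modC (f (x +i* y) - (f p + d * (x +i* y - p))) <= e / 4 * s.
  move=> xx yy.
  have le_s : modC (x +i* y - p) <= s.
    rewrite (le_trans (ler_modC_ReIm _))//; case: (p) x1p px2 y1p py2 => a b /= *.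
    by apply: lerD; rewrite ler_norml; lra.
  rewrite opprD addrA (le_trans (rP _ I (le_lt_trans le_s sr)))//.
  by rewrite ler_wpM2l// ltW.
have x12 : x1 <= x2 by lra.
have y12 : y1 <= y2 by lra.
have s0 : 0 <= e / 4 * s by rewrite mulr_ge0 ?(ltW e4)// /s; lra.
have eH y : y1 <= y <= y2 ->
    modC (H (x2 +i* y) - q (x2 +i* y) - (H (x1 +i* y) - q (x1 +i* y))) <= e / 4 * s * s.
  move=> yy; apply: (@le_trans _ _ (e / 4 * s * `|x2 - x1|)).
    apply: (@mean_value_hor (fun z => H z - q z) (fun z => f z - (f p + d * (z - p)))).
    move=> x; rewrite !ler_norml (ger0_norm (_ : 0 <= x2 - x1)); last by lra.
    by move=> *; split; [exact: hasDB|apply: near => //; lra].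
  by rewrite ler_wpM2l// ger0_norm /s; lra.
have eV x : x1 <= x <= x2 ->
    modC (V (x +i* y2) - q (x +i* y2) - (V (x +i* y1) - q (x +i* y1))) <= e / 4 * s * s.
  move=> xx; apply: (@le_trans _ _ (e / 4 * s * `|y2 - y1|)).
    apply: (@mean_value_ver (fun z => V z - q z) (fun z => f z - (f p + d * (z - p)))).
    move=> y; rewrite !ler_norml (ger0_norm (_ : 0 <= y2 - y1)); last by lra.
    by move=> *; split; [exact: hasDB|apply: near => //; lra].
  by rewrite ler_wpM2l// ger0_norm /s; lra.
have [? ? ? ?] : [/\ x1 <= x1 <= x2, x1 <= x2 <= x2, y1 <= y1 <= y2 & y1 <= y2 <= y2].
  by rewrite !lexx x12 y12.
have -> : rect_int H V x1 x2 y1 y2 =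
    (H (x2 +i* y1) - q (x2 +i* y1) - (H (x1 +i* y1) - q (x1 +i* y1)))
  + (V (x2 +i* y2) - q (x2 +i* y2) - (V (x2 +i* y1) - q (x2 +i* y1)))
  - (H (x2 +i* y2) - q (x2 +i* y2) - (H (x1 +i* y2) - q (x1 +i* y2)))
  - (V (x1 +i* y2) - q (x1 +i* y2) - (V (x1 +i* y1) - q (x1 +i* y1))).
  by rewrite /rect_int; ring.
have -> : e * s ^+ 2 = e / 4 * s * s + e / 4 * s * s + e / 4 * s * s + e / 4 * s * s.
  by field.
do 2 (rewrite (le_trans (ler_modCB _ _))// lerD ?eH ?eV//).
by rewrite (le_trans (ler_modCD _ _))// lerD ?eH ?eV.
Qed.

Lemma nested_segments (a b : nat -> R) : (forall n, a n <= a n.+1) ->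
  (forall n, b n.+1 <= b n) -> (forall n, a n <= b n) ->
  exists x, forall n, a n <= x <= b n.
Proof.
move=> ai bd ab.
have am m n : (m <= n)%N -> a m <= a n by move: m n; exact/nondecreasing_seqP.
have bm m n : (m <= n)%N -> b n <= b m by move: m n; exact/nonincreasing_seqP.
have amb m n : a m <= b n.
  have [mn|/ltnW nm] := leqP m n; first by rewrite (le_trans (am _ _ mn)).
  by rewrite (le_trans (ab _))// bm.
exists (sup (range a)) => n; apply/andP; split.
  by apply: ub_le_sup; [exists (b 0%N) => _ [m _ <-]|exists n].
by apply: ge_sup; [exists (a 0%N), 0%N|move=> _ [m _ <-]].
Qed.

Lemma exists_half_pow (A e : R) : 0 < e -> exists n, A / 2 ^+ n < e.
Proof.
move=> e0; have [A0|/ltW A0] := leP A 0.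
  by exists 0%N; rewrite expr0 divr1 (le_lt_trans A0).
have Ae0 : 0 <= A / e by rewrite divr_ge0// ltW.
exists (Num.bound (A / e)); rewrite ltr_pdivrMr ?exprn_gt0//.
rewrite -ltr_pdivrMl// mulrC (lt_trans (archi_boundP Ae0))//.
by rewrite -natrX ltr_nat ltn_expl.
Qed.

(** Bisection: some quarter carries at least a quarter of the integral, and its squared size is a
    quarter of the former one, so the bound [K * size ^+ 2] from below persists. At the common point
    of the nested rectangles, differentiability gives [K / 2 * size ^+ 2] from above. *)
Lemma goursat f H V : (forall z, hasD (hor z) H z (f z)) ->
  (forall z, hasD (ver z) V z (f z)) -> (forall z, exists d, hasD setT f z d) ->
  forall x1 x2 y1 y2, rect_int H V x1 x2 y1 y2 = 0.
Proof.
move=> dH dV df.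
(* Exchanging two opposite sides only changes the sign, so the corners may be assumed ordered. *)
suff main x1 x2 y1 y2 : x1 <= x2 -> y1 <= y2 -> rect_int H V x1 x2 y1 y2 = 0.
  move=> x1 x2 y1 y2.
  have sx : rect_int H V x1 x2 y1 y2 = - rect_int H V x2 x1 y1 y2.
    by rewrite /rect_int; ring.
  have sy a b : rect_int H V a b y1 y2 = - rect_int H V a b y2 y1.
    by rewrite /rect_int; ring.
  have [xx|/ltW xx] := leP x1 x2; have [yy|/ltW yy] := leP y1 y2.
  - exact: main.
  - by rewrite sy main// oppr0.
  - by rewrite sx main// oppr0.
  - by rewrite sx sy main// !oppr0.
move=> x12 y12; apply/eqP; rewrite -modC_eq0; apply/negPn/negP => I0.
have {}I0 : 0 < modC (rect_int H V x1 x2 y1 y2) by rewrite lt_def I0 modC_ge0.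
pose size (s : R * R * (R * R)) := s.1.2 - s.1.1 + (s.2.2 - s.2.1).
pose int (s : R * R * (R * R)) := rect_int H V s.1.1 s.1.2 s.2.1 s.2.2.
pose s0 := ((x1, x2), (y1, y2)).
have [size0|size0] := eqVneq (size s0) 0.
  move: I0; have : x2 - x1 = 0 by move: size0; rewrite /size /=; lra.
  have : y2 - y1 = 0 by move: size0; rewrite /size /=; lra.
  move=> /eqP; rewrite subr_eq0 => /eqP -> /eqP; rewrite subr_eq0 => /eqP ->.
  by rewrite /rect_int !subrr addr0 !subr0 modC0 ltxx.
have {}size0 : 0 < size s0 by rewrite lt_def size0 /size /=; lra.
pose K := modC (int s0) / size s0 ^+ 2.
have K0 : 0 < K by rewrite divr_gt0// exprn_gt0.
pose Q (s : R * R * (R * R)) := [/\ s.1.1 <= s.1.2, s.2.1 <= s.2.2 &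
  K * size s ^+ 2 <= modC (int s)].
pose sub (s t : R * R * (R * R)) := [/\ s.1.1 <= t.1.1, t.1.2 <= s.1.2,
  s.2.1 <= t.2.1, t.2.2 <= s.2.2 & size t = size s / 2].
have /choice[next nextP] s : exists t, Q s -> Q t /\ sub s t.
  case: (pselect (Q s)) => [|nQ]; last by exists s.
  case: s => -[a b] [c d] [/= ab cd Ks].
  pose m := (a + b) / 2; pose n := (c + d) / 2.
  have : exists2 t, sub (a, b, (c, d)) t /\ t.1.1 <= t.1.2 /\ t.2.1 <= t.2.2 &
      modC (int (a, b, (c, d))) <= 4 * modC (int t).
    have split4 : int (a, b, (c, d)) = int (a, m, (c, n)) + int (m, b, (c, n)) +
        int (a, m, (n, d)) + int (m, b, (n, d)).
      by rewrite /int /rect_int /=; ring.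
    have : modC (int (a, b, (c, d))) <= modC (int (a, m, (c, n))) +
        modC (int (m, b, (c, n))) + modC (int (a, m, (n, d))) + modC (int (m, b, (n, d))).
      rewrite split4; do 2 rewrite (le_trans (ler_modCD _ _))// lerD//.
      exact: ler_modCD.
    move=> le4.
    have ok t : t \in [:: (a, m, (c, n)); (m, b, (c, n)); (a, m, (n, d)); (m, b, (n, d))] ->
        sub (a, b, (c, d)) t /\ t.1.1 <= t.1.2 /\ t.2.1 <= t.2.2.
      by rewrite !inE => /or4P[] /eqP ->; rewrite /sub /size /m /n /=;
        (split; [split; lra|split; lra]).
    have [?|] := leP (modC (int (a, b, (c, d)))) (4 * modC (int (a, m, (c, n)))).
      by exists (a, m, (c, n)) => //; apply: ok; rewrite !inE eqxx.
    have [?|] := leP (modC (int (a, b, (c, d)))) (4 * modC (int (m, b, (c, n)))).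
      by exists (m, b, (c, n)) => //; apply: ok; rewrite !inE eqxx orbT.
    have [?|] := leP (modC (int (a, b, (c, d)))) (4 * modC (int (a, m, (n, d)))).
      by exists (a, m, (n, d)) => //; apply: ok; rewrite !inE eqxx !orbT.
    move=> A B C; exists (m, b, (n, d)); first by apply: ok; rewrite !inE eqxx !orbT.
    lra.
  case=> t [st [t1 t2]] le4; exists t => _; split=> //; split=> //.
  have [_ _ _ _ ->] := st.
  by rewrite expr_div_n; lra.
pose s n := iter n next s0.
have sQ n : Q (s n).
  elim: n => [|n /nextP[]//]; split => //=.
  by rewrite /K divfK// gt_eqF// exprn_gt0.
have ss n : sub (s n) (s n.+1) by have [] := nextP _ (sQ n).
have [px pxP] : exists x, forall n, (s n).1.1 <= x <= (s n).1.2.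
  by apply: nested_segments => n; [have [] := ss n|have [] := ss n|have [] := sQ n].
have [py pyP] : exists y, forall n, (s n).2.1 <= y <= (s n).2.2.
  by apply: nested_segments => n; [have [] := ss n|have [] := ss n|have [] := sQ n].
have [d dfp] := df (px +i* py).
have K2 : 0 < K / 2 by rewrite divr_gt0.
have [r r0 rP] := rect_int_small dH dV dfp K2.
have size_s n : size (s n) = size s0 / 2 ^+ n.
  elim: n => [|n IH]; first by rewrite expr0 divr1.
  by have [_ _ _ _ ->] := ss n; rewrite IH exprSr invfM mulrA.
have [n] := exists_half_pow (size s0) r0; rewrite -size_s => nr.
have [_ _ Kn] := sQ n.
have := rP _ _ _ _ (pxP n) (pyP n) nr.
rewrite -/(int (s n)) -/(size (s n)) => /(le_trans Kn).
rewrite leNgt => /negP; apply.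
rewrite ltr_pM2r; first by lra.
by rewrite exprn_gt0// size_s divr_gt0// exprn_gt0.
Qed.

(** [F] integrates [f] from 0 along the real axis to [Re z], then vertically to [z]. Goursat's
    theorem on the rectangle between the real axis and height [y] turns an increment of [F] into a
    horizontal step at height [y] and a vertical step, both close to the base point. *)
Lemma primitive_entire f : (forall z, exists d, hasD setT f z d) ->
  exists F, forall z, hasD setT F z (f z).
Proof.
move=> df.
have cf : contC setT f by apply: hasD_contC => z _; exact: df.
have [H dH] := primitive_hor cf; have [V dV] := primitive_ver cf.
have G := goursat dH dV df.
pose F z := H (Re z +i* 0) - H 0 + (V z - V (Re z +i* 0)).
exists F => z e e0; have e2 : 0 < e / 2 by rewrite divr_gt0.
(* Points of the two steps are controlled through [|Re| + |Im|], at most twice the modulus: hence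
   [r / 2]. *)
have [r r0 rP] := cf z Logic.I _ e2; exists (r / 2); first by rewrite divr_gt0.
case: z rP => x y rP [x' y'] _ wz.
have -> : F (x' +i* y') - F (x +i* y) = H (x' +i* y) - H (x +i* y) +
    (V (x' +i* y') - V (x' +i* y)).
  by apply/eqP; rewrite /F /= -subr_eq0 -(G x x' 0 y) /rect_int; apply/eqP; ring.
set w := x' +i* y' - x +i* y in wz *.
pose q z := f (x +i* y) * z.
have dq S z : hasD S q z (f (x +i* y)).
  by rewrite -[X in hasD _ _ _ X]mulr1; apply: hasDZ; exact: hasD_id.
have wx : `|x' - x| <= modC w := ler_Re_modC w.
have wy : `|y' - y| <= modC w := ler_Im_modC w.
have near a b : `|a - x| <= `|x' - x| -> `|b - y| <= `|y' - y| ->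
    modC (f (a +i* b) - f (x +i* y)) <= e / 2.
  move=> ax yb; apply/ltW/rP => //; rewrite (le_lt_trans (ler_modC_ReIm _))//=.
  by lra.
have -> : H (x' +i* y) - H (x +i* y) + (V (x' +i* y') - V (x' +i* y)) - f (x +i* y) * w =
   (H (x' +i* y) - q (x' +i* y) - (H (x +i* y) - q (x +i* y))) +
   (V (x' +i* y') - q (x' +i* y') - (V (x' +i* y) - q (x' +i* y))).
  by rewrite /q /w; ring.
rewrite (le_trans (ler_modCD _ _))// [in leRHS](splitr e) mulrDl lerD//.
  apply: (@le_trans _ _ (e / 2 * `|x' - x|)); last by rewrite ler_wpM2l// ltW.
  apply: (@mean_value_hor (fun z => H z - q z) (fun z => f z - f (x +i* y))) => a ax _.
  by split; [exact: hasDB|apply: near => //; rewrite subrr normr0].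
apply: (@le_trans _ _ (e / 2 * `|y' - y|)); last by rewrite ler_wpM2l// ltW.
apply: (@mean_value_ver (fun z => V z - q z) (fun z => f z - f (x +i* y))) => b yb _.
by split; [exact: hasDB|exact: near].
Qed.
End Goursat.

(** * Cauchy's formula on a square *)

Section SegmentIntegral.
Context {R : realType}.
Implicit Types (f g F G : R[i] -> R[i]) (z w p q a b c d : R[i]).

(* The whole line through [p] and [q], not only the part between them. *)
Definition segment p q := lin p (q - p).

(** The increment of a primitive along the line, with default value 0 if there is none; [segintE]
    shows that the choice of the primitive does not matter. *)
Definition segint p q g : R[i] :=
  xget 0 [set v | exists2 G, forall z, segment p q z -> hasD (segment p q) G z (g z)
    & v = G q - G p].

Lemma segment_at p q (t : R) : segment p q (p + t%:C * (q - p)).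
Proof. by exists t. Qed.

Lemma segintE p q g G :
  (forall z, segment p q z -> hasD (segment p q) G z (g z)) ->
  segint p q g = G q - G p.
Proof.
move=> dG; rewrite /segint; case: xgetP => [_ _ [H dH ->]|/(_ (G q - G p))]; last first.
  by case; exists G.
apply/eqP; rewrite -subr_eq0 -modC_eq0 eq_le modC_ge0 andbT.
rewrite (_ : _ - _ = H q - G q - (H p - G p)); last by ring.
have := @mean_value_le _ (fun z => H z - G z) (fun=> 0) p q 0.
rewrite mul0r; apply => t _ /=; split; last by rewrite modC0.
by rewrite -(subrr (g (p + t%:C * (q - p)))); apply: hasDB; [apply: dH|apply: dG]; exact: segment_at.
Qed.

Definition diff_on (S : set R[i]) f := forall z, S z -> exists d, hasD S f z d.

Lemma primitive_segment p q g : p != q -> diff_on (segment p q) g ->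
  exists G, forall z, segment p q z -> hasD (segment p q) G z (g z).
Proof.
move=> pq dg; apply: primitive_lin; first by rewrite subr_eq0 eq_sym.
exact: hasD_contC.
Qed.

Lemma eq_segint p q f g : (forall z, segment p q z -> f z = g z) ->
  segint p q f = segint p q g.
Proof.
move=> fg; rewrite /segint; set A := [set _ | _]; set B := [set _ | _].
suff -> : A = B by [].
by apply/seteqP; split=> v [G dG ->]; exists G => // z zpq;
  [rewrite -fg|rewrite fg] => //; exact: dG.
Qed.

Lemma segintZD p q c f g : p != q -> diff_on (segment p q) f ->
  diff_on (segment p q) g ->
  segint p q (fun z => c * f z + g z) = c * segint p q f + segint p q g.
Proof.
move=> pq /(primitive_segment pq)[F dF] /(primitive_segment pq)[G dG].
rewrite (segintE dF) (segintE dG) (@segintE _ _ _ (fun z => c * F z + G z)).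
  by ring.
by move=> z zpq; apply: hasDD; [apply: hasDZ; exact: dF|exact: dG].
Qed.

Lemma segint_le p q g (M : R) : p != q -> diff_on (segment p q) g ->
  (forall t : R, 0 <= t <= 1 -> modC (g (p + t%:C * (q - p))) <= M) ->
  modC (segint p q g) <= M * modC (q - p).
Proof.
move=> pq /(primitive_segment pq)[G dG] gM; rewrite (segintE dG).
by apply: (@mean_value_le _ G g) => t t01 /=; split; [exact/dG/segment_at|exact: gM].
Qed.

(* The j-th corner, counterclockwise from [1 - i], of the square with corners
   [±1 ± i]. *)
Definition corner (j : nat) : R[i] := 'i ^+ j * (1 - 'i).

Definition sqint g := \sum_(j < 4) segint (corner j) (corner j.+1) g.

Definition edges : set R[i] := [set z | exists j : nat, segment (corner j) (corner j.+1) z].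

Lemma corner_diff j : corner j.+1 - corner j = 'i ^+ j * (2 * 'i).
Proof.
by rewrite /corner exprSr -mulrA -mulrBr; congr (_ * _); rewrite mulrBr -expr2 sqr_i; ring.
Qed.

Lemma modC_iX j : modC ('i ^+ j : R[i]) = 1.
Proof. by rewrite modCX modC_i expr1n. Qed.

Lemma modC_corner_diff j : modC (corner j.+1 - corner j) = 2.
Proof. by rewrite corner_diff modCM modC_iX modCM modC_i modC_nat mul1r mulr1. Qed.

Lemma corner_neq j : corner j != corner j.+1.
Proof.
by rewrite eq_sym -subr_eq0 -modC_eq0 modC_corner_diff pnatr_eq0.
Qed.

(** Each edge is the right-hand one, where the real part is 1, rotated by ['i ^+ j]; estimates on
    the edges are made after undoing the rotation. *)
Lemma edge_param j (t : R) :
  corner j + t%:C * (corner j.+1 - corner j) = 'i ^+ j * (1 +i* (2 * t - 1)).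
Proof.
rewrite corner_diff /corner mulrCA -mulrDr; congr (_ * _).
by apply/eqP; rewrite eq_complex /=; apply/andP; split; apply/eqP; ring.
Qed.

Lemma edges_ge1 z : edges z -> 1 <= modC z.
Proof.
move=> [j [t ->]]; rewrite edge_param modCM modC_iX mul1r.
by apply: le_trans (ler_Re_modC _); rewrite /= ger0_norm.
Qed.

Lemma sqint_primitive g G : (forall z, edges z -> hasD edges G z (g z)) -> sqint g = 0.
Proof.
move=> dG; rewrite /sqint.
have E (j : 'I_4) : true -> segint (corner j) (corner j.+1) g = G (corner j.+1) - G (corner j).
  move=> _; apply: segintE => z zj; apply: (@hasD_sub _ edges).
    by move=> w wj; exists j.
  by apply: dG; exists j.
rewrite (eq_bigr _ E) -(big_mkord xpredT (fun j => G (corner j.+1) - G (corner j))).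
(* The path closes up: [corner 4 = corner 0], because [i^4 = 1]. *)
rewrite telescope_sumr// /corner expr0 (exprD _ 2 2) sqr_i.
by rewrite mulrNN mulr1 mul1r subrr.
Qed.

Lemma diff_edge g j : diff_on edges g -> diff_on (segment (corner j) (corner j.+1)) g.
Proof.
move=> dg z zj; have [|d zd] := dg z; first by exists j.
by exists d; apply: hasD_sub zd => w wj; exists j.
Qed.

Lemma sqintZD c f g : diff_on edges f -> diff_on edges g ->
  sqint (fun z => c * f z + g z) = c * sqint f + sqint g.
Proof.
move=> df dg; rewrite /sqint mulr_sumr -big_split /=; apply: eq_bigr => j _.
by apply: segintZD; [exact: corner_neq|exact: diff_edge|exact: diff_edge].
Qed.

Lemma eq_sqint f g : (forall z, edges z -> f z = g z) -> sqint f = sqint g.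
Proof.
move=> fg; apply: eq_bigr => j _; apply: eq_segint => z zj.
by apply: fg; exists j.
Qed.

(** 8 is the perimeter: four edges of length 2. *)
Lemma sqint_le g (M : R) : diff_on edges g ->
  (forall (j : 'I_4) (t : R), 0 <= t <= 1 ->
    modC (g (corner j + t%:C * (corner j.+1 - corner j))) <= M) ->
  modC (sqint g) <= 8 * M.
Proof.
move=> dg gM; rewrite (le_trans (modC_sum _ _ _))//.
apply: (@le_trans _ _ (\sum_(j < 4) M * 2)); last first.
  by rewrite sumr_const card_ord -mulr_natr; lra.
apply: ler_sum => j _; rewrite -(modC_corner_diff j); apply: segint_le => //.
- exact: corner_neq.
- exact: diff_edge.
- exact: gM.
Qed.

(* On the j-th edge [1 / z] is within [3 / 5] of the constant [3 / (4 i^j)]. *)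
Lemma sqint_inv_neq0 : sqint (fun z => z^-1) != 0.
Proof.
pose c : R[i] := (3 / 4)%:C.
have dinv : diff_on edges (fun z => z^-1).
  move=> z /edges_ge1 z1; exists (- z^-1 ^+ 2); apply: hasDV.
  by rewrite -modC_gt0 (lt_le_trans _ z1).
have near (j : nat) : modC (segint (corner j) (corner j.+1) (fun z => z^-1) - 2 * 'i * c) <= 6 / 5.
  have cst : segint (corner j) (corner j.+1) (fun=> c * 'i ^- j) = 2 * 'i * c.
    rewrite (@segintE _ _ _ (fun z => c * 'i ^- j * z)).
      rewrite -mulrBr corner_diff; field.
      by rewrite -modC_eq0 modC_iX oner_eq0.
    by move=> z _; rewrite -[X in hasD _ _ _ X]mulr1; apply: hasDZ; exact: hasD_id.
  have dcst d : diff_on (segment (corner j) (corner j.+1)) (fun=> d).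
    by move=> z _; exists 0; exact: hasD_cst.
  have dinvj := diff_edge (j := j) dinv.
  rewrite addrC -mulN1r -cst -(segintZD (-1) (corner_neq j) (dcst _) dinvj).
  apply: (@le_trans _ _ (3 / 5 * modC (corner j.+1 - corner j))); last first.
    by rewrite modC_corner_diff; lra.
  apply: segint_le; first exact: corner_neq.
    move=> z zj; have [d zd] := dinvj z zj; exists (-1 * 0 + d).
    by apply: hasDD => //; apply: hasDZ; exact: hasD_cst.
  move=> t /andP[t0 t1]; rewrite edge_param.
  set w := 1 +i* _.
  have w2 : modC w ^+ 2 = 1 + (2 * t - 1) ^+ 2 by rewrite sqr_modC /= expr1n.
  have w0 : 0 < modC w by rewrite lt_def modC_ge0 andbT -sqrf_eq0 w2 gt_eqF// ltr_pwDl ?sqr_ge0.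
  have -> : -1 * (c * 'i ^- j) + ('i ^+ j * w)^-1 = 'i ^- j * ((1 - c * w) / w).
    by field; rewrite -modC_gt0 w0 -modC_gt0 modC_iX ltr01.
  rewrite modCM modCV modC_iX invr1 mul1r modCM modCV ler_pdivrMr//.
  rewrite -(ler_pXn2r (n := 2)) ?nnegrE ?modC_ge0 ?mulr_ge0 ?modC_ge0//.
  (* With [s = 2 t - 1] this is [1/16 + 9/16 s^2 <= 9/25 (1 + s^2)], which holds since
     [s^2 <= 1]. *)
  rewrite exprMn w2 sqr_modC /=.
  by have := sqr_ge0 t; nra.
(* The constants alone would give [8 i c = 6 i], and the four errors add up to at most
   [24 / 5 < 6]. *)
have dist : modC (sqint (fun z => z^-1) - 8 * 'i * c) <= 4 * (6 / 5).
  have -> : 8 * 'i * c = \sum_(j < 4) 2 * 'i * c by rewrite sumr_const card_ord -mulr_natr; ring.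
  rewrite /sqint -sumrB (le_trans (modC_sum _ _ _))//.
  apply: (@le_trans _ _ (\sum_(j < 4) 6 / 5)); first exact: ler_sum.
  by rewrite sumr_const card_ord -mulr_natr; lra.
apply/eqP => W0; move: dist; rewrite W0 sub0r modCN !modCM modC_i modC_nat mulr1.
by rewrite modC_real ger0_norm; lra.
Qed.

End SegmentIntegral.

(** * Cauchy-type integrals and their derivatives in the parameter *)

Section Cauchy.
Context {R : realType}.
Implicit Types (f g F G : R[i] -> R[i]) (z w p q a b c d : R[i]).

Lemma diff_onM S f g : diff_on S f -> diff_on S g -> diff_on S (fun z => f z * g z).
Proof.
move=> df dg z Sz; have [a fa] := df z Sz; have [b gb] := dg z Sz.
by eexists; exact: hasDM fa gb.
Qed.

Lemma diff_onX S f k : diff_on S f -> diff_on S (fun z => f z ^+ k).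
Proof.
move=> df; elim: k => [|k IH].
  by move=> z _; exists 0; under eq_fun do rewrite expr0; exact: hasD_cst.
by under eq_fun do rewrite exprS; exact: diff_onM.
Qed.

Lemma hasD_subV S c z : z != c -> hasD S (fun w => (w - c)^-1) z (- (z - c)^-1 ^+ 2).
Proof.
move=> zc; have sub : hasD S (fun w => w - c) z 1.
  by rewrite -[X in hasD _ _ _ X]subr0; apply: hasDB; [exact: hasD_id|exact: hasD_cst].
have z0 : z - c != 0 by rewrite subr_eq0.
by have := hasD_comp (fun _ _ => Logic.I) sub (hasDV setT z0); rewrite mulr1.
Qed.

(** The factor [1 / (2 pi i)] is omitted; [cauchy (fun=> 1) 1 0] takes its place as
    normalization. *)
Definition cauchy F k a := sqint (fun z => F z * (z - a)^-1 ^+ k).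

Lemma edges_neq z a : edges z -> modC a < 2^-1 -> z != a.
Proof.
by move=> /edges_ge1 z1 a2; apply/eqP => za; move: z1; rewrite za leNgt (lt_trans a2)// invf_lt1// ltr1n.
Qed.

Lemma diff_kernel F k a : diff_on setT F -> modC a < 2^-1 ->
  diff_on edges (fun z => F z * (z - a)^-1 ^+ k).
Proof.
move=> dF a2; apply: diff_onM.
  by move=> z _; have [d dz] := dF z Logic.I; exists d; exact: hasD_sub dz.
apply: diff_onX => z ez; eexists; apply: hasD_subV; exact: edges_neq.
Qed.

Lemma bounded_edges F : diff_on setT F -> exists2 B : R, 0 <= B &
  forall (j : 'I_4) (t : R), 0 <= t <= 1 ->
    modC (F (corner j + t%:C * (corner j.+1 - corner j))) <= B.
Proof.
move=> dF.
have /choice[B BP] (j : 'I_4) : exists b : R, forall t : R, 0 <= t <= 1 ->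
    modC (F (corner j + t%:C * (corner j.+1 - corner j))) <= b.
  pose phi (t : R) : R := modC (F (corner j + t%:C * (corner j.+1 - corner j))).
  have cphi : continuous phi.
    move=> t; apply/cvgrPdist_lt => e e0; pose z := corner j + t%:C * (corner j.+1 - corner j).
    have [d /hasD_continuous/(_ e e0)[r r0 rP]] := dF z Logic.I.
    apply/nbhs_ballP; exists (r / 2); first by rewrite /= divr_gt0.
    move=> s; rewrite /ball /= => ts.
    set w := corner j + s%:C * (corner j.+1 - corner j).
    have wz : modC (w - z) < r.
      rewrite (_ : w - z = (s - t)%:C * (corner j.+1 - corner j)).
        by rewrite modCM modC_real modC_corner_diff -ltr_pdivlMr// distrC.
      by rewrite /w /z rmorphB /=; ring.
    have {rP wz} := rP w Logic.I wz; apply: le_lt_trans; rewrite /phi -/z -/w.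
    rewrite ler_norml; apply/andP; split.
      have := ler_modCD (F w - F z) (F z); rewrite subrK; lra.
    have := ler_modCB (F w) (F w - F z); rewrite subKr; lra.
  have [c _ cP] := EVT_max ler01 (continuous_subspaceT cphi).
  by exists (phi c) => t t01; apply: cP; rewrite in_itv.
exists (\sum_(j < 4) `|B j|); first exact: sumr_ge0.
move=> j t /(BP j t)/le_trans; apply; rewrite (bigD1 j)//=.
by rewrite (le_trans (ler_norm _))// lerDl sumr_ge0.
Qed.

Lemma expr_resolvent k : exists2 C : R, 0 <= C & forall u v h : R[i],
  modC u <= 2 -> modC v <= 2 -> v - u = h * u * v ->
  modC (v ^+ k - u ^+ k) <= C * modC h /\
  modC (v ^+ k - u ^+ k - k%:R * h * u ^+ k.+1) <= C * modC h ^+ 2.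
Proof.
elim: k => [|k [C C0 IH]].
  by exists 0 => // u v h _ _ _; rewrite !expr0 subrr !mul0r subr0 modC0.
pose C' := 2 * C + 2 ^+ k * 4.
have C'0 : 0 <= C' by rewrite addr_ge0 ?mulr_ge0 ?exprn_ge0.
exists (2 * C + 2 * C'); first by rewrite addr_ge0 ?mulr_ge0.
move=> u v h u2 v2 uv; have [IH1 IH2] := IH u v h u2 v2 uv.
have h0 := modC_ge0 h.
have le1 : modC (v ^+ k.+1 - u ^+ k.+1) <= C' * modC h.
  have -> : v ^+ k.+1 - u ^+ k.+1 = v * (v ^+ k - u ^+ k) + u ^+ k * (v - u).
    by rewrite !exprS; ring.
  rewrite (le_trans (ler_modCD _ _))// uv !modCM modCX mulrDl lerD//.
    by rewrite -mulrA ler_pM ?modC_ge0.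
  rewrite -[leRHS]mulrA ler_pM ?exprn_ge0 ?mulr_ge0 ?modC_ge0//.
    by rewrite lerXn2r ?nnegrE ?modC_ge0.
  rewrite -mulrA mulrC ler_wpM2r//.
  by rewrite (_ : 4 = 2 * 2); [rewrite ler_pM ?modC_ge0|ring].
split; first by rewrite (le_trans le1)// ler_wpM2r// /C'; have := exprn_ge0 k (ler0n R 2); lra.
have -> : v ^+ k.+1 - u ^+ k.+1 - k.+1%:R * h * u ^+ k.+2 =
   u * (v ^+ k - u ^+ k - k%:R * h * u ^+ k.+1) + h * u * (v ^+ k.+1 - u ^+ k.+1).
  have -> : v ^+ k.+1 - u ^+ k.+1 - k.+1%:R * h * u ^+ k.+2 =
    u * (v ^+ k - u ^+ k - k%:R * h * u ^+ k.+1) + v ^+ k * (v - u) - h * u ^+ k.+2.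
    by rewrite !exprS -(natr1 k); ring.
  by rewrite uv !exprS; ring.
rewrite (le_trans (ler_modCD _ _))// !modCM mulrDl lerD//.
  by rewrite -[leRHS]mulrA ler_pM ?modC_ge0.
rewrite expr2 (_ : 2 * C' * _ = modC h * 2 * (C' * modC h)); last by ring.
by rewrite ler_pM ?mulr_ge0 ?modC_ge0// ler_wpM2l.
Qed.

(** Differentiation under the integral: the error is the integral of [F] times the remainder of
    [expr_resolvent], at most [8 B C |w - a|^2]. *)
Lemma hasD_cauchy F k a : diff_on setT F -> modC a < 2^-1 ->
  hasD setT (cauchy F k) a (k%:R * cauchy F k.+1 a).
Proof.
move=> dF a2 e e0; have [C C0 CP] := expr_resolvent k.
have [B B0 BP] := bounded_edges dF.
have BC0 : 0 < 8 * (B * C) + 1 by rewrite ltr_wpDl// !mulr_ge0.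
exists (Num.min (2^-1 - modC a) (e / (8 * (B * C) + 1))).
  by rewrite lt_min subr_gt0 a2 divr_gt0.
move=> w _; rewrite lt_min ltr_pdivlMr// => /andP[wa we].
have w2 : modC w < 2^-1.
  by have := ler_modCD (w - a) a; rewrite subrK; lra.
have dk := diff_kernel (F := F).
have -> : cauchy F k w - cauchy F k a - k%:R * cauchy F k.+1 a * (w - a) =
  sqint (fun z => - (k%:R * (w - a)) * (F z * (z - a)^-1 ^+ k.+1) +
    (-1 * (F z * (z - a)^-1 ^+ k) + F z * (z - w)^-1 ^+ k)).
  rewrite (sqintZD (- (k%:R * (w - a))) (dk k.+1 _ dF a2)).
    by rewrite (sqintZD (-1) (dk k _ dF a2) (dk k _ dF w2)) /cauchy; ring.
  move=> z ez; have [d1 h1] := dk k _ dF a2 z ez; have [d2 h2] := dk k _ dF w2 z ez.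
  by eexists; exact: hasDD (hasDZ (-1) h1) h2.
apply: (@le_trans _ _ (8 * (B * (C * modC (w - a) ^+ 2)))).
  apply: sqint_le.
    move=> z ez; have [d1 h1] := dk k _ dF a2 z ez; have [d2 h2] := dk k _ dF w2 z ez.
    have [d3 h3] := dk k.+1 _ dF a2 z ez.
    by eexists; exact: hasDD (hasDZ _ h3) (hasDD (hasDZ (-1) h1) h2).
  move=> j t t01; have ez : edges (corner j + t%:C * (corner j.+1 - corner j)).
    by exists j, t.
  have := BP j t t01; move: ez; set z := _ + _ => ez Fz.
  set u := (z - a)^-1; set v := (z - w)^-1.
  have small b : modC b < 2^-1 -> modC (z - b)^-1 <= 2.
    move=> b2; have := edges_ge1 ez; have := ler_modCD (z - b) b; rewrite subrK => ? ?.
    by rewrite modCV invf_ple ?posrE//; lra.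
  have uv : v - u = (w - a) * u * v.
    by rewrite /u /v; field; rewrite !subr_eq0 !(edges_neq ez).
  have -> : - (k%:R * (w - a)) * (F z * u ^+ k.+1) + (-1 * (F z * u ^+ k) + F z * v ^+ k)
     = F z * (v ^+ k - u ^+ k - k%:R * (w - a) * u ^+ k.+1) by ring.
  have [_ le2] := CP u v (w - a) (small _ a2) (small _ w2) uv.
  by rewrite modCM ler_pM ?modC_ge0.
rewrite (_ : 8 * _ = modC (w - a) * (8 * (B * C)) * modC (w - a)); last by ring.
rewrite ler_wpM2r ?modC_ge0// (le_trans _ (ltW we))// ler_wpM2l ?modC_ge0//.
by rewrite lerDl.
Qed.

(** [F] is compared with [q], a primitive of the affine approximation of [f] at [a]; the mean value
    inequality turns an error [e |w - a|] on the derivatives into [e |w - a|^2]. *)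
Lemma taylor2 F f a d : (forall z, hasD setT F z (f z)) -> hasD setT f a d ->
  forall e : R, 0 < e -> exists2 r : R, 0 < r & forall w, modC (w - a) < r ->
    modC (F w - F a - f a * (w - a) - d / 2 * (w - a) ^+ 2) <= e * modC (w - a) ^+ 2.
Proof.
move=> dF df e e0; have [r r0 rP] := df e e0; exists r => // w wa.
pose q z := f a * z + (d / 2) * ((z - a) * (z - a)).
have dq S z : hasD S q z (f a + d * (z - a)).
  have dl : hasD S (fun w => w - a) z (1 - 0) by apply: hasDB; [exact: hasD_id|exact: hasD_cst].
  have := hasDD (hasDZ (f a) (hasD_id S z)) (hasDZ (d / 2) (hasDM dl dl)).
  by congr hasD; last by field.
rewrite (_ : _ - _ = F w - q w - (F a - q a)); last by rewrite /q; ring.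
rewrite [_ ^+ 2]expr2 mulrA.
apply: (@mean_value_le _ (fun z => F z - q z) (fun z => f z - (f a + d * (z - a)))).
move=> t /andP[t0 t1] /=; split; first by apply: hasDB; [exact: hasD_sub (dF _)|exact: dq].
set z := a + _; have za : modC (z - a) <= modC (w - a).
  by rewrite /z addrC addKr modCM modC_real ger0_norm// ler_piMl ?modC_ge0.
rewrite opprD addrA (le_trans (rP z Logic.I _))//; first exact: le_lt_trans wa.
by rewrite ler_wpM2l// ltW.
Qed.

(** The difference quotient [q] has derivative [d / 2] at [a], by [taylor2]. Being differentiable
    everywhere it has a primitive, so its integral is 0; splitting [q] gives the formula. *)
Lemma cauchy_formula F f a : (forall z, hasD setT F z (f z)) -> diff_on setT f ->
  modC a < 2^-1 -> cauchy F 1 a = F a * cauchy (fun=> 1) 1 a.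
Proof.
move=> dF df a2.
pose q z := if z == a then f a else (F z - F a) * (z - a)^-1.
have [z|Q dQ] := @primitive_entire _ q.
  have [->|za] := eqVneq z a.
    have [d fd] := df a Logic.I; exists (d / 2) => e e0.
    have [r r0 rP] := taylor2 dF fd e0; exists r => // w _ wa.
    have [->|wna] := eqVneq w a; first by rewrite !subrr mulr0 subr0 modC0 mulr0.
    have wa0 : w - a != 0 by rewrite subr_eq0.
    rewrite /q eqxx (negbTE wna) -(ler_pM2r (_ : 0 < modC (w - a))) ?modC_gt0//.
    rewrite -modCM -[leRHS]mulrA -[modC (w - a) * modC (w - a)]expr2; have := rP w wa.
    by congr (modC _ <= _); field.
  have h1 : hasD setT (fun w => F w - F a) z (f z - 0).
    by apply: hasDB; [exact: dF|exact: hasD_cst].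
  eexists; apply: (hasD_loc (r := modC (z - a))) (hasDM h1 (hasD_subV setT za)) => //.
    by rewrite modC_gt0 subr_eq0.
  move=> w _; rewrite /q; case: eqVneq => // ->.
  by rewrite modCB ltxx.
have E0 : sqint q = 0 by apply: sqint_primitive => z _; exact: hasD_sub (dQ z).
have d1 : diff_on [set: R[i]] (fun=> 1) by move=> z _; exists 0; exact: hasD_cst.
have dF' : diff_on setT F by move=> z _; exists (f z).
have : sqint q = - F a * cauchy (fun=> 1) 1 a + cauchy F 1 a.
  rewrite /cauchy -sqintZD; [|exact: diff_kernel|exact: diff_kernel].
  apply: eq_sqint => z ez; rewrite /q (negbTE (edges_neq ez a2)) !expr1; ring.
by rewrite E0 => /esym/eqP; rewrite addrC mulNr subr_eq0 => /eqP.
Qed.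

(** The derivative in the parameter is the integral of [1 / (z - b)^2], which has the primitive
    [- 1 / (z - b)] along the edges. *)
Lemma cauchy1_cst a : modC a < 2^-1 -> cauchy (fun=> 1) 1 a = cauchy (fun=> 1) 1 0.
Proof.
move=> a2; have d1 : diff_on [set: R[i]] (fun=> 1) by move=> z _; exists 0; exact: hasD_cst.
apply/eqP; rewrite -subr_eq0 -modC_eq0 eq_le modC_ge0 andbT.
have := @mean_value_le _ (cauchy (fun=> 1) 1) (fun=> 0) 0 a 0; rewrite mul0r.
apply => t /andP[t0 t1] /=; split; last by rewrite modC0.
rewrite subr0 add0r; set b := _ * a.
have b2 : modC b < 2^-1.
  by rewrite (le_lt_trans _ a2)// modCM modC_real ger0_norm// ler_piMl ?modC_ge0.
apply: (@hasD_sub _ setT) => //.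
have := hasD_cauchy 1 d1 b2; rewrite mul1r.
have -> : cauchy (fun=> 1) 2 b = 0.
  apply: (@sqint_primitive _ _ (fun z => -1 * (z - b)^-1)) => z ez.
  have -> : 1 * (z - b)^-1 ^+ 2 = -1 * - (z - b)^-1 ^+ 2 by ring.
  apply: hasDZ.
  by apply: hasD_subV; exact: edges_neq.
by [].
Qed.

Lemma cauchy1_neq0 : cauchy (fun=> 1) 1 0 != 0.
Proof.
rewrite /cauchy; under [sqint _]eq_sqint => z _ do rewrite mul1r subr0 expr1.
exact: sqint_inv_neq0.
Qed.

Lemma hasDT_local f g z d (r : R) : 0 < r -> (forall w, modC (w - z) < r -> f w = g w) ->
  hasD setT f z d -> hasD setT g z d.
Proof. by move=> r0 fg; apply: (hasD_loc r0) => // w _; exact: fg. Qed.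

(** Near 0, differentiating [F = W^-1 * cauchy F 1] twice identifies [f] and then [g] with
    Cauchy-type integrals of [F], which can be differentiated once more. *)
Lemma derivative_entire_at0 F f g : (forall z, hasD setT F z (f z)) ->
  (forall z, hasD setT f z (g z)) -> exists d, hasD setT g 0 d.
Proof.
move=> dF df; set W := cauchy (fun=> 1) 1 0; have W0 : W != 0 := cauchy1_neq0.
have dF' : diff_on setT F by move=> z _; exists (f z).
have df' : diff_on setT f by move=> z _; exists (g z).
have near a : modC a < 2^-1 -> exists2 r : R, 0 < r & forall w, modC (w - a) < r -> modC w < 2^-1.
  move=> a2; exists (2^-1 - modC a) => [|w wa]; first by rewrite subr_gt0.
  by have := ler_modCD (w - a) a; rewrite subrK; lra.
have FE a : modC a < 2^-1 -> F a = W^-1 * cauchy F 1 a.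
  by move=> a2; rewrite (cauchy_formula dF df' a2) cauchy1_cst// mulrCA mulVf ?mulr1.
have fE a : modC a < 2^-1 -> f a = W^-1 * cauchy F 2 a.
  move=> a2; have [r r0 rP] := near a a2.
  have := hasDT_local r0 (fun w wa => FE w (rP w wa)) (dF a) => /hasDT_unique; apply.
  by apply: hasDZ; have := hasD_cauchy 1 dF' a2; rewrite mul1r.
have gE a : modC a < 2^-1 -> W^-1 * (2 * cauchy F 3 a) = g a.
  move=> a2; have [r r0 rP] := near a a2.
  have := hasDT_local r0 (fun w wa => fE w (rP w wa)) (df a) => /hasDT_unique E.
  by apply/esym/E; apply: hasDZ; exact: hasD_cauchy.
have z2 : modC (0 : R[i]) < 2^-1 by rewrite modC0 invr_gt0.
have [r r0 rP] := near 0 z2.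
eexists; apply: (hasDT_local r0 (fun w wa => gE w (rP w wa))).
by apply: hasDZ; apply: hasDZ; exact: hasD_cauchy.
Qed.

Lemma derivative_entire f g : (forall z, hasD setT f z (g z)) ->
  forall z, exists d, hasD setT g z d.
Proof.
move=> df c; have [F dF] := primitive_entire (fun z => ex_intro _ _ (df z)).
have [||d gd] := @derivative_entire_at0 (fun z => F (z + c)) (fun z => f (z + c)) (fun z => g (z + c)).
- by move=> z; apply: hasD_shift.
- by move=> z; apply: hasD_shift.
have := @hasD_shift _ (fun z => g (z + c)) c (- c) d; rewrite subrr => /(_ gd).
by under eq_fun do rewrite subrK; exists d.
Qed.

End Cauchy.

(** * Power series *)

Section PowerSeries.
Context {R : realType}.
Implicit Types (f g F G : R[i] -> R[i]) (z w : R[i]) (b : nat -> R[i]).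

Lemma le_half_pow (A x y : R) : (forall m, x <= A / 2 ^+ m + y) -> x <= y.
Proof.
move=> H; rewrite leNgt; apply/negP; rewrite -subr_gt0 => /(exists_half_pow A)[n].
by have := H n; lra.
Qed.

Lemma half_powS (A : R) n : A / 2 ^+ n.+1 = A / 2 ^+ n / 2.
Proof. by rewrite exprSr invfM mulrA. Qed.

Lemma half_pow_ge0 (A : R) n : 0 <= A -> 0 <= A / 2 ^+ n.
Proof. by move=> A0; rewrite divr_ge0// exprn_ge0. Qed.

(** The intervals of radius [2 C / 2 ^+ n] around [u n] are nested, and [l] is a common point. *)
Lemma geometric_limit_real (u : nat -> R) (C : R) :
  (forall n, `|u n.+1 - u n| <= C / 2 ^+ n) ->
  exists l, forall n, `|l - u n| <= 2 * C / 2 ^+ n.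
Proof.
move=> H.
have [||n|l lP] := @nested_segments _ (fun n => u n - 2 * (C / 2 ^+ n)) (fun n => u n + 2 * (C / 2 ^+ n)).
- by move=> n; have := H n; rewrite ler_norml half_powS => /andP[]; lra.
- by move=> n; have := H n; rewrite ler_norml half_powS => /andP[]; lra.
- by have := le_trans (normr_ge0 _) (H n); lra.
by exists l => n; have /andP[? ?] := lP n; rewrite -mulrA ler_norml; apply/andP; split; lra.
Qed.

Lemma geometric_dist (u : nat -> R[i]) (C : R) :
  (forall n, modC (u n.+1 - u n) <= C / 2 ^+ n) ->
  forall n m, modC (u (n + m)%N - u n) <= 2 * C / 2 ^+ n.
Proof.
move=> H n m; suff : modC (u (n + m)%N - u n) <= 2 * (C / 2 ^+ n) - 2 * (C / 2 ^+ (n + m)).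
  have := le_trans (modC_ge0 _) (H (n + m)%N); lra.
elim: m => [|m IH]; first by rewrite addn0 !subrr modC0.
rewrite addnS half_powS (_ : _ - u n = u (n + m).+1 - u (n + m)%N + (u (n + m)%N - u n)); last by ring.
by have := ler_modCD (u (n + m).+1 - u (n + m)%N) (u (n + m)%N - u n); have := H (n + m)%N; lra.
Qed.

(** [l] is fixed before [C]: a limit taken pointwise can then be estimated with a constant valid on
    a whole disc. *)
Lemma geometric_limit (u : nat -> R[i]) (C0 : R) :
  (forall n, modC (u n.+1 - u n) <= C0 / 2 ^+ n) ->
  exists l, forall C : R, (forall n, modC (u n.+1 - u n) <= C / 2 ^+ n) ->
    forall n, modC (l - u n) <= 2 * C / 2 ^+ n.
Proof.
move=> H.
have ReB z w : Re (z - w) = Re z - Re w by case: z w => ? ? [].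
have ImB z w : Im (z - w) = Im z - Im w by case: z w => ? ? [].
have [x xP] : exists x, forall n, `|x - Re (u n)| <= 2 * C0 / 2 ^+ n.
  by apply: geometric_limit_real => n; rewrite -ReB (le_trans (ler_Re_modC _)).
have [y yP] : exists y, forall n, `|y - Im (u n)| <= 2 * C0 / 2 ^+ n.
  by apply: geometric_limit_real => n; rewrite -ImB (le_trans (ler_Im_modC _)).
exists (x +i* y) => C HC n; apply: (@le_half_pow (4 * C0)) => m.
have <- : x +i* y - u (n + m)%N + (u (n + m)%N - u n) = x +i* y - u n by ring.
rewrite (le_trans (ler_modCD _ _))// lerD//; last exact: geometric_dist.
have C00 : 0 <= C0 by have := le_trans (modC_ge0 _) (H 0%N); rewrite expr0 divr1.
apply: (@le_trans _ _ (4 * C0 / 2 ^+ (n + m))).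
  rewrite (le_trans (ler_modC_ReIm _))// ReB ImB /=.
  by have := xP (n + m)%N; have := yP (n + m)%N; lra.
rewrite ler_wpM2l ?mulr_ge0// lef_pV2 ?posrE ?exprn_gt0//.
by rewrite ler_weXn2l ?ler1n// leq_addl.
Qed.

(** The increment of [G - p n] from [z] to [w] is at most [C / 2 ^+ n * |w - z|]: by the mean value
    inequality this holds for [p m - p n] up to terms in [C / 2 ^+ m], and [m] is arbitrary. *)
Lemma hasD_limit (p p' : nat -> R[i] -> R[i]) G G' :
  (forall n z, hasD setT (p n) z (p' n z)) ->
  (forall r : R, exists C : R, forall n z, modC z <= r ->
    modC (G z - p n z) <= C / 2 ^+ n /\ modC (G' z - p' n z) <= C / 2 ^+ n) ->
  forall z, hasD setT G z (G' z).
Proof.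
move=> dp H z e e0; have [C CP] := H (modC z + 1).
have C0 : 0 <= C.
  have [|+ _] := CP 0%N z; first by rewrite lerDl.
  by rewrite expr0 divr1; apply: le_trans; exact: modC_ge0.
have e4 : 0 < e / 4 by rewrite divr_gt0.
have [n nP] := exists_half_pow C e4.
have e2 : 0 < e / 2 by rewrite divr_gt0.
have [r r0 rP] := dp n z _ e2.
exists (Num.min r 1); first by rewrite lt_min r0 ltr01.
move=> w _; rewrite lt_min => /andP[wr w1].
have inball v : modC (v - z) <= modC (w - z) -> modC v <= modC z + 1.
  by have := ler_modCD (v - z) z; rewrite subrK; lra.
have win : modC w <= modC z + 1 by apply: inball.
have zin : modC z <= modC z + 1 by rewrite lerDl.
have h0 := modC_ge0 (w - z).
have A : modC (G w - p n w - (G z - p n z)) <= C / 2 ^+ n * modC (w - z).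
  apply: (@le_half_pow (C * (2 + modC (w - z)))) => m.
  have -> : G w - p n w - (G z - p n z) =
    (p m w - p n w - (p m z - p n z)) + ((G w - p m w) - (G z - p m z)) by ring.
  have B : modC (p m w - p n w - (p m z - p n z)) <= (C / 2 ^+ m + C / 2 ^+ n) * modC (w - z).
    apply: (@mean_value_le _ (fun v => p m v - p n v) (fun v => p' m v - p' n v)) => t /andP[t0 t1] /=.
    split; first by apply: (@hasD_sub _ setT) => //; apply: hasDB; exact: dp.
    set v := z + _; have vin : modC v <= modC z + 1.
      by apply: inball; rewrite /v addrC addKr modCM modC_real ger0_norm// ler_piMl.
    have [_ D1] := CP m v vin; have [_ D2] := CP n v vin.
    have := ler_modCB (G' v - p' n v) (G' v - p' m v).
    by rewrite opprB addrC addrA subrK; lra.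
  have [D1 _] := CP m w win; have [D2 _] := CP m z zin.
  rewrite (le_trans (ler_modCD _ _))//; have := ler_modCB (G w - p m w) (G z - p m z).
  have -> : C * (2 + modC (w - z)) / 2 ^+ m = C / 2 ^+ m * 2 + C / 2 ^+ m * modC (w - z) by ring.
  by rewrite mulrDl in B; lra.
have -> : G w - G z - G' z * (w - z) = (G w - p n w - (G z - p n z)) +
  (p n w - p n z - p' n z * (w - z)) - (G' z - p' n z) * (w - z) by ring.
have [_ D] := CP n z zin.
rewrite (le_trans (ler_modCB _ _))// modCM.
have E := ler_wpM2r h0 D; have F := ler_modCD (G w - p n w - (G z - p n z)) (p n w - p n z - p' n z * (w - z)).
have I := rP w Logic.I wr; have J := ler_wpM2r h0 (ltW nP).
lra.
Qed.

(** Infinite radius of convergence, without limits: the bound for the radius [2 r] makes the terms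
    on the disc of radius [r] at most [C / 2 ^+ k]. *)
Definition entire_coef b := forall r : R, 0 <= r ->
  exists C : R, forall k, modC (b k) * r ^+ k <= C.

Definition psum b n w := \sum_(k < n) b k * w ^+ k.

Lemma psumS b n w : psum b n.+1 w = psum b n w + b n * w ^+ n.
Proof. by rewrite /psum big_ord_recr. Qed.

Lemma psum_dist b (C : R) (r : R) : (forall k, modC (b k) * (2 * r) ^+ k <= C) ->
  forall w, modC w <= r -> forall n, modC (psum b n.+1 w - psum b n w) <= C / 2 ^+ n.
Proof.
move=> H w wr n; rewrite psumS addrC addKr modCM modCX ler_pdivlMr ?exprn_gt0//.
have w0 := modC_ge0 w; rewrite -mulrA -exprMn (le_trans _ (H n))// ler_wpM2l ?modC_ge0//.
by rewrite lerXn2r ?nnegrE ?mulr_ge0//; lra.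
Qed.

Lemma pseries_limit b : entire_coef b -> exists G, forall r : R, exists C : R,
  forall n z, modC z <= r -> modC (G z - psum b n z) <= C / 2 ^+ n.
Proof.
move=> eb.
have dist (r : R) : exists C : R, forall w, modC w <= r -> forall n,
    modC (psum b n.+1 w - psum b n w) <= C / 2 ^+ n.
  have [r0|r0] := leP 0 r; last by exists 0 => w wr; have := modC_ge0 w; lra.
  have [|C CP] := eb (2 * r); first by rewrite mulr_ge0.
  by exists C; exact: psum_dist.
have /choice[G GP] w : exists l, forall C : R,
    (forall n, modC (psum b n.+1 w - psum b n w) <= C / 2 ^+ n) ->
    forall n, modC (l - psum b n w) <= 2 * C / 2 ^+ n.
  have [C CP] := dist (modC w); apply: (@geometric_limit _ C) => n.
  exact: CP.
exists G => r; have [C CP] := dist r; exists (2 * C) => n z zr.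
by apply: GP => k; exact: CP.
Qed.

Lemma entire_coef_shift b N : entire_coef b -> entire_coef (fun k => b (N + k)%N).
Proof.
move=> eb r r0; have [C CP] := eb (r + 1) (addr_ge0 r0 ler01).
exists C => k; rewrite (le_trans _ (CP (N + k)%N))// ler_wpM2l ?modC_ge0// exprD.
have r1 : 0 <= r + 1 by rewrite addr_ge0.
apply: (@le_trans _ _ ((r + 1) ^+ k)); first by rewrite lerXn2r ?nnegrE// lerDl.
by rewrite ler_peMl ?exprn_ge0// exprn_ege1// lerDr.
Qed.

Lemma entire_coef_deriv b : entire_coef b -> entire_coef (fun k => k.+1%:R * b k.+1).
Proof.
(* The factor 2 absorbs [k.+1 <= 2 ^+ k.+1], and [r + 1] absorbs the shift of the exponent. *)
move=> eb r r0; have [C CP] := eb (2 * (r + 1)) (mulr_ge0 (ler0n _ 2) (addr_ge0 r0 ler01)).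
exists C => k; rewrite (le_trans _ (CP k.+1))// modCM modC_nat mulrAC mulrC.
rewrite ler_wpM2l ?modC_ge0// exprMn.
rewrite ler_pM ?exprn_ge0//.
  by rewrite -natrX ler_nat ltnW// ltn_expl.
have r1 : 0 <= r + 1 by rewrite addr_ge0.
apply: (@le_trans _ _ ((r + 1) ^+ k)); first by rewrite lerXn2r ?nnegrE// lerDl.
by rewrite exprS ler_peMl ?exprn_ge0// lerDr.
Qed.

Lemma hasDX S n z : hasD S (fun w => w ^+ n.+1) z (n.+1%:R * z ^+ n).
Proof.
elim: n => [|n IH].
  by rewrite expr0 mulr1; under eq_fun do rewrite expr1; exact: hasD_id.
have := hasDM (hasD_id S z) IH; congr hasD; last by rewrite -(natr1 n.+1) exprS; ring.
Qed.

Lemma hasD_psum b n z : hasD setT (psum b n) z (psum (fun k => k.+1%:R * b k.+1) n.-1 z).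
Proof.
have E m : psum b m.+1 = fun w => psum b m w + b m * w ^+ m by apply/funext => w; exact: psumS.
elim: n => [|[|n] IH] /=.
- have -> : psum b 0 = fun=> 0 by apply/funext => w; rewrite /psum big_ord0.
  by rewrite /psum big_ord0; exact: hasD_cst.
- have -> : psum b 1 = fun=> b 0%N.
    by apply/funext => w; rewrite /psum big_ord1 expr0 mulr1.
  by rewrite /psum big_ord0; exact: hasD_cst.
rewrite E psumS (_ : _ * _ * _ = b n.+1 * (n.+1%:R * z ^+ n)); last by ring.
by apply: hasDD; [exact: IH|apply: hasDZ; exact: hasDX].
Qed.

Lemma pseries_entire b G : entire_coef b ->
  (forall r : R, exists C : R, forall n z, modC z <= r ->
    modC (G z - psum b n z) <= C / 2 ^+ n) ->
  forall z, exists d, hasD setT G z d.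
Proof.
move=> eb GP; have [G' GP'] := pseries_limit (entire_coef_deriv eb).
move=> z; exists (G' z).
apply: (@hasD_limit (fun n => psum b n.+1) (fun n => psum (fun k => k.+1%:R * b k.+1) n)).
  by move=> n v; exact: hasD_psum.
move=> r; have [C CP] := GP r; have [C' CP'] := GP' r; exists (`|C| + `|C'|) => n v vr.
have C0 := half_pow_ge0 n (normr_ge0 C); have C'0 := half_pow_ge0 n (normr_ge0 C').
have D : C / 2 ^+ n <= `|C| / 2 ^+ n by rewrite ler_wpM2r ?invr_ge0 ?exprn_ge0// ler_norm.
have D' : C' / 2 ^+ n <= `|C'| / 2 ^+ n by rewrite ler_wpM2r ?invr_ge0 ?exprn_ge0// ler_norm.
rewrite mulrDl; split; last by have := CP' n v vr; lra.
by have := CP n.+1 v vr; rewrite half_powS; lra.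
Qed.

(** The two sides have the same partial sums, hence are equal. The factor [z ^+ N] of the remainder
    is what later hides it from the first iterates. *)
Lemma pseries_tail b G N GN : entire_coef b ->
  (forall r : R, exists C : R, forall n z, modC z <= r ->
    modC (G z - psum b n z) <= C / 2 ^+ n) ->
  (forall r : R, exists C : R, forall n z, modC z <= r ->
    modC (GN z - psum (fun k => b (N + k)%N) n z) <= C / 2 ^+ n) ->
  forall z, G z = psum b N z + z ^+ N * GN z.
Proof.
move=> eb GP GNP z; apply/eqP; rewrite -subr_eq0 -modC_eq0 eq_le modC_ge0 andbT.
have [C CP] := GP (modC z); have [D DP] := GNP (modC z).
have split n : psum b (N + n) z = psum b N z + z ^+ N * psum (fun k => b (N + k)%N) n z.
  rewrite /psum big_split_ord /= mulr_sumr; congr (_ + _); apply: eq_bigr => i _.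
  by rewrite exprD; ring.
apply: (@le_half_pow (`|C| + modC z ^+ N * D)) => n; rewrite addr0.
have -> : G z - (psum b N z + z ^+ N * GN z) = (G z - psum b (N + n) z) -
   z ^+ N * (GN z - psum (fun k => b (N + k)%N) n z) by rewrite split; ring.
rewrite (le_trans (ler_modCB _ _))// mulrDl lerD//.
  rewrite (le_trans (CP (N + n)%N z (lexx _)))//.
  rewrite (le_trans (ler_wpM2r _ (ler_norm C))) ?invr_ge0 ?exprn_ge0//.
  rewrite ler_wpM2l// lef_pV2 ?posrE ?exprn_gt0//.
  by rewrite ler_weXn2l ?ler1n// leq_addl.
by rewrite modCM modCX -mulrA ler_wpM2l ?exprn_ge0 ?modC_ge0// DP.
Qed.

(** Follows from [x ^+ k / k! <= exp x] with [x = rho * r]. *)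
Lemma entire_coef_factorial b (M rho : R) : 0 <= rho -> 0 <= M ->
  (forall k, modC (b k) <= M * rho ^+ k / k`!%:R) -> entire_coef b.
Proof.
move=> rho0 M0 H r r0; exists (M * expR (rho * r)) => k.
rewrite (le_trans (ler_wpM2r _ (H k))) ?exprn_ge0//.
have -> : M * rho ^+ k / k`!%:R * r ^+ k = M * ((rho * r) ^+ k / k`!%:R).
  by rewrite exprMn; ring.
rewrite ler_wpM2l//; have x0 : 0 <= rho * r by rewrite mulr_ge0.
case: k => [|k]; first by rewrite expr0 fact0 divr1 -expR0 ler_expR.
by rewrite (le_trans _ (expR_ge1Dxn k x0))// lerDr.
Qed.

End PowerSeries.

(** * Iterates of P(D) *)

Section Operator.
Context {R : realType}.
Implicit Types (f g u v y : R[i] -> R[i]) (z w c : R[i]).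

Definition holo f := forall z, exists d, hasD setT f z d.

Definition D1 f : R[i] -> R[i] := derive1 (f : R[i]^o -> R[i]^o).

Lemma hasD_D1 f z d : hasD setT f z d -> D1 f z = d.
Proof. by move=> /hasDP[_ <-]; rewrite /D1 derive1E. Qed.

Lemma holoD1 f z : holo f -> hasD setT f z (D1 f z).
Proof. by move=> /(_ z)[d fd]; rewrite (hasD_D1 fd). Qed.

Lemma entireP f : @entire R f <-> holo f.
Proof.
split=> [H z|H z].
  by have /derivableP/hasDP fd := H z; eexists; exact: fd.
by have [d /hasDP[]] := H z.
Qed.

Lemma holo_D1 f : holo f -> holo (D1 f).
Proof. by move=> hf; apply: (@derivative_entire _ f) => z; exact: holoD1. Qed.

Lemma holo_cst c : holo (fun=> c).
Proof. by move=> z; exists 0; exact: hasD_cst. Qed.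

Lemma holo_id : holo id.
Proof. by move=> z; exists 1; exact: hasD_id. Qed.

Lemma holoD f g : holo f -> holo g -> holo (fun z => f z + g z).
Proof. by move=> hf hg z; eexists; apply: hasDD; exact: holoD1. Qed.

Lemma holoM f g : holo f -> holo g -> holo (fun z => f z * g z).
Proof. by move=> hf hg z; eexists; apply: hasDM; exact: holoD1. Qed.

Lemma holoZ c f : holo f -> holo (fun z => c * f z).
Proof. by apply: holoM; exact: holo_cst. Qed.

Lemma holoX f n : holo f -> holo (fun z => f z ^+ n).
Proof.
move=> hf; elim: n => [|n IH].
  by under eq_fun do rewrite expr0; exact: holo_cst.
by under eq_fun do rewrite exprS; exact: holoM.
Qed.

Lemma holo_sum (I : Type) (r : seq I) (F : I -> R[i] -> R[i]) :
  (forall i, holo (F i)) -> holo (fun z => \sum_(i <- r) F i z).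
Proof.
move=> hF; elim: r => [|i r IH].
  by under eq_fun do rewrite big_nil; exact: holo_cst.
by under eq_fun do rewrite big_cons; exact: holoD.
Qed.

Lemma holo_comp f g : holo f -> holo g -> holo (fun z => f (g z)).
Proof.
move=> hf hg z; eexists.
exact: (hasD_comp (fun _ _ => Logic.I) (holoD1 z hg) (holoD1 (g z) hf)).
Qed.

Definition Dn s f : R[i] -> R[i] := derive1n s (f : R[i]^o -> R[i]^o).

Lemma DnS s f : Dn s.+1 f = D1 (Dn s f). Proof. by []. Qed.

Lemma DnSr s f : Dn s.+1 f = Dn s (D1 f). Proof. exact: iterSr. Qed.

Lemma holo_Dn s f : holo f -> holo (Dn s f).
Proof. by move=> hf; elim: s => [//|s IH]; rewrite DnS; exact: holo_D1. Qed.

Lemma D1_lin c f g : holo f -> holo g ->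
  D1 (fun z => c * f z + g z) = fun z => c * D1 f z + D1 g z.
Proof.
by move=> hf hg; apply/funext => z; apply: hasD_D1; apply: hasDD; [apply: hasDZ|]; exact: holoD1.
Qed.

Lemma Dn_lin s c f g : holo f -> holo g ->
  Dn s (fun z => c * f z + g z) = fun z => c * Dn s f z + Dn s g z.
Proof.
by move=> hf hg; elim: s => [//|s IH]; rewrite !DnS IH D1_lin//; exact: holo_Dn.
Qed.

Variable P : {poly R[i]}.

Definition T f : R[i] -> R[i] := @poly_D R P f.

Lemma TE f z : T f z = \sum_(s < size P) P`_s * Dn s f z. Proof. by []. Qed.

Lemma holo_T f : holo f -> holo (T f).
Proof. by move=> hf; apply: holo_sum => s; apply: holoZ; exact: holo_Dn. Qed.

Lemma holo_iterT n f : holo f -> holo (iter n T f).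
Proof. by move=> hf; elim: n => [//|n IH]; exact: holo_T. Qed.

Lemma T_lin c f g : holo f -> holo g ->
  T (fun z => c * f z + g z) = fun z => c * T f z + T g z.
Proof.
move=> hf hg; apply/funext => z; rewrite !TE mulr_sumr -big_split /=.
by apply: eq_bigr => s _; rewrite Dn_lin//; ring.
Qed.

Lemma iterT_lin n c f g : holo f -> holo g ->
  iter n T (fun z => c * f z + g z) = fun z => c * iter n T f z + iter n T g z.
Proof.
by move=> hf hg; elim: n => [//|n IH]; rewrite iterS IH T_lin//; exact: holo_iterT.
Qed.

Lemma iterT_cst n c : exists c', iter n T (fun=> c) = fun=> c'.
Proof.
have Dcst s d : exists d', Dn s (fun=> d) = fun=> d'.
  elim: s d => [|s IH] d; first by exists d.
  have [d' E] := IH d; exists 0; rewrite DnS E; apply/funext => z.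
  by apply: hasD_D1; exact: hasD_cst.
have /choice[e eP] : forall s, exists d', Dn s (fun=> c) = fun=> d' by move=> s; exact: Dcst.
elim: n => [|n [c' IH]]; first by exists c.
have /choice[e' eP'] : forall s, exists d', Dn s (fun=> c') = fun=> d' by move=> s; exact: Dcst.
exists (\sum_(s < size P) P`_s * e' s); rewrite iterS IH; apply/funext => z.
by rewrite TE; apply: eq_bigr => s _; rewrite eP'.
Qed.

Variables (y : R[i] -> R[i]) (z0 : R[i]).
Hypotheses (hy : holo y) (y0 : y z0 = 0).

Lemma D1_powM k u : holo u -> D1 (fun z => y z ^+ k.+1 * u z) =
  fun z => y z ^+ k * (k.+1%:R * D1 y z * u z + y z * D1 u z).
Proof.
move=> hu; apply/funext => z; apply: hasD_D1.
have := hasDM (hasD_comp (fun _ _ => Logic.I) (holoD1 z hy) (hasDX setT k (y z))) (holoD1 z hu).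
by congr hasD; rewrite exprS; ring.
Qed.

(** A derivative lowers the power of [y] by one and multiplies the cofactor at [z0] by the exponent
    and by [y' z0], the term [y u'] being 0 there. The exponents multiply to [(j + s)! / j!], stated
    without division. *)
Lemma Dn_powM s j u : holo u -> exists2 v, holo v &
  Dn s (fun z => y z ^+ (j + s) * u z) = (fun z => y z ^+ j * v z) /\
  v z0 * j`!%:R = (j + s)`!%:R * D1 y z0 ^+ s * u z0.
Proof.
elim: s u => [|s IH] u hu.
  by exists u => //; rewrite addn0 expr0 mulr1 mulrC.
have hu1 : holo (fun z => (j + s).+1%:R * D1 y z * u z + y z * D1 u z).
  by apply: holoD; apply: holoM => //; [apply: holoZ|]; exact: holo_D1.
have [v hv [Ev v0]] := IH _ hu1.
exists v => //; rewrite DnSr addnS D1_powM//; split=> //.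
by rewrite v0 y0 mul0r addr0 factS natrM exprS; ring.
Qed.

Let t := (size P).-1.

(** Once [y ^ j] is factored out, the derivative of order [s < t] keeps [y ^ (t - s)] and vanishes
    at [z0]: the value there comes from the leading term of [P] alone. *)
Lemma T_powM j u : (1 < size P)%N -> holo u -> exists2 v, holo v &
  T (fun z => y z ^+ (j + t) * u z) = (fun z => y z ^+ j * v z) /\
  v z0 * j`!%:R = (j + t)`!%:R * (lead_coef P * D1 y z0 ^+ t) * u z0.
Proof.
move=> P1 hu.
have st : size P = t.+1 by rewrite /t prednK// ltnW.
have /choice[v vP] (s : nat) : exists v, (s <= t)%N -> [/\ holo v,
    Dn s (fun z => y z ^+ (j + t) * u z) = (fun z => y z ^+ (j + (t - s)) * v z) &
    v z0 * (j + (t - s))`!%:R = (j + t)`!%:R * D1 y z0 ^+ s * u z0].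
  case: (leqP s t) => [le_st|]; last by exists u.
  have [v hv [Ev v0]] := Dn_powM s (j + (t - s)) hu.
  by exists v => _; rewrite -addnA subnK// in Ev v0; split.
exists (fun z => \sum_(s < size P) P`_s * (y z ^+ (t - s) * v s z)).
  apply: holo_sum => s; apply: holoZ; apply: holoM; first exact: holoX.
  by have [] := vP s; first by rewrite -ltnS -st.
split.
  apply/funext => z; rewrite TE mulr_sumr; apply: eq_bigr => s _.
  have [|_ -> _] := vP s; first by rewrite -ltnS -st.
  by rewrite exprD; ring.
rewrite st big_ord_recr /= big1 ?add0r; last first.
  by move=> s _; rewrite y0 expr0n subn_eq0 leqNgt ltn_ord /= mul0r mulr0.
rewrite subnn expr0 mul1r lead_coefE -/t.
have [//|_ _ E] := vP t; rewrite subnn addn0 in E.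
by rewrite -[LHS]mulrA E; ring.
Qed.

Lemma iterT_powM n j u : (1 < size P)%N -> holo u -> exists2 v, holo v &
  iter n T (fun z => y z ^+ (j + n * t) * u z) = (fun z => y z ^+ j * v z) /\
  v z0 * j`!%:R = (j + n * t)`!%:R * (lead_coef P * D1 y z0 ^+ t) ^+ n * u z0.
Proof.
move=> P1; elim: n u => [|n IH] u hu.
  by exists u => //; rewrite mul0n addn0 expr0 mulr1 mulrC.
have [u1 hu1 [Eu1 u1z]] := T_powM (j + n * t) P1 hu.
have [v hv [Ev vz]] := IH u1 hu1.
exists v => //; rewrite iterSr mulSn (addnC t) addnA Eu1; split=> //.
set K := lead_coef P * _ in vz u1z *.
have E : (j + n * t)`!%:R * K ^+ n * u1 z0 = K ^+ n * (u1 z0 * (j + n * t)`!%:R) by ring.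
by rewrite vz E u1z exprS; ring.
Qed.

End Operator.

(** * Uniform convergence on compact sets *)

Section Topology.
Context {R : realType}.
Implicit Types (f g : R[i] -> R[i]) (z w c : R[i]).

(** A singleton is compact, so evaluation at a point is continuous. *)
Lemma nbhs_eval f z (e : R) : 0 < e ->
  nbhs (f : CC R) [set g : CC R | modC (g z - f z) < e].
Proof.
move=> e0; have ec : 0 < e%:C by rewrite ltcR.
have := @fam_nbhs _ _ compact [set z : R[i]^o] _ (f : CC R)
  (@entourage_ball _ R[i]^o (PosNum ec)) (@compact_set1 _ (z : R[i]^o)).
apply: filterS => g /(_ z erefl); rewrite /ball /= normrC ltcR.
by rewrite modCB.
Qed.

Lemma holo_bounded_compact f (K : set R[i]^o) : holo f -> compact K ->
  exists r : R, forall z, K z -> modC (f z) <= r.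
Proof.
move=> hf cK.
have cont : continuous ((fun z => modC (f z)) : R[i]^o -> R).
  move=> z B /nbhs_ballP[e /= e0 eB]; apply: (iffRL (nbhs_ballP _ _)).
  have [d /hasD_continuous/(_ e e0)[r r0 rP]] := hf z.
  exists r%:C; first by rewrite /= ltcR.
  move=> w; rewrite /ball /= normrC ltcR modCB => /(rP w Logic.I) wz.
  apply: eB; rewrite /ball /= distrC; apply: le_lt_trans wz.
  rewrite ler_norml; apply/andP; split.
    by have := ler_modCB (f w) (f w - f z); rewrite subKr; lra.
  by have := ler_modCB (f z) (f z - f w); rewrite subKr (modCB (f z)); lra.
have cI := continuous_compact (continuous_subspaceT cont) cK.
have [M [_ MP]] := compact_bounded cI.
exists (M + 1) => z Kz.
by apply: le_trans (ler_norm _) (MP (M + 1) _ _ _); [rewrite ltrDl|exists z].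
Qed.

(** On a compact set [f] is bounded and [g] takes its values in a disc, on which the partial sums
    converge uniformly to [G]. *)
Lemma closed_pseries (F : set (CC R)) f g b G :
  closed F -> holo f -> holo g ->
  (forall r : R, exists C : R, forall n z, modC z <= r ->
    modC (G z - psum b n z) <= C / 2 ^+ n) ->
  (forall n, F (fun z => f z * psum b n (g z))) -> F (fun z => f z * G (g z)).
Proof.
move=> cF hf hg GP FP.
pose p (n : nat) : CC R := fun z => f z * psum b n (g z).
pose h : CC R := fun z => f z * G (g z).
suff cv : p n @[n --> \oo] --> h.
  by apply: (closed_cvg F cF) cv; apply: nearW.
apply/fam_cvgP => K cK Q /uniform_nbhs[E [entE EQ]].
move: entE; rewrite -entourage_from_ballE => -[[e e'] /=].
rewrite ltcE /= => /andP[/eqP -> e0] eE.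
have [r rP] := holo_bounded_compact hg cK; have [s sP] := holo_bounded_compact hf cK.
have [C CP] := GP r; have [N NP] := exists_half_pow (`|s| * `|C|) e0.
exists N => // n /= Nn; apply: EQ => z Kz; apply: eE.
rewrite /ball /= normrC ltcR -mulrBr modCM (le_lt_trans _ NP)// -mulrA.
apply: ler_pM; [exact: modC_ge0|exact: modC_ge0| |].
  by rewrite (le_trans (sP z Kz))// ler_norm.
rewrite (le_trans (CP n _ (rP z Kz)))//.
rewrite (le_trans (ler_wpM2r _ (ler_norm C))) ?invr_ge0 ?exprn_ge0//.
by rewrite ler_wpM2l// lef_pV2 ?posrE ?exprn_gt0// ler_weXn2l ?ler1n.
Qed.

End Topology.

(** * An element of the algebra whose orbit avoids 0 *)

Section Main.
Context {R : realType}.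
Variables (P : {poly R[i]}).
Hypothesis P1 : (1 < size P)%N.
Let t := (size P).-1.

(** The orbit consists of constants, and no constant is within 1/2 of the identity both at 0 and at
    1. *)
Lemma cst_not_HC c : ~ HC (@entire R) (@poly_D R P) (fun=> c).
Proof.
move=> [_ dense].
have id_entire : @entire R (id : R[i] -> R[i]) by apply/entireP; exact: holo_id.
have h0 : 0 < 2^-1 :> R by rewrite invr_gt0.
have [_ [[n _ <-]]] := dense _ id_entire _
  (filterI (@nbhs_eval R id 0 _ h0) (@nbhs_eval R id 1 _ h0)).
have [c' E] := iterT_cst P n c; rewrite -/(T P) in E *.
move=> -[] /=; rewrite [iter _ _ _]E subr0 => A B.
by have := ler_modCB c' (c' - 1); rewrite subKr modC1; lra.
Qed.

(** Without such a point [f f'] is identically 0, so [f * f] has derivative 0 and is constant.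
    Passing to the square spares a study of the zeros of [f] and [f']. *)
Lemma nonconstant_point (f : R[i] -> R[i]) : holo f -> (forall c, (fun z => f z * f z) <> fun=> c) ->
  exists z0, f z0 != 0 /\ D1 f z0 != 0.
Proof.
move=> hf ncst; apply: contrapT => H.
apply: (ncst (f 0 * f 0)); apply/funext => z.
have D0 w : hasD setT (fun z => f z * f z) w 0.
  have := hasDM (holoD1 w hf) (holoD1 w hf); congr hasD.
  have [->|fw] := eqVneq (f w) 0; first by ring.
  have [->|dw] := eqVneq (D1 f w) 0; first by ring.
  by exfalso; apply: H; exists w.
apply/eqP; rewrite -subr_eq0 -modC_eq0 eq_le modC_ge0 andbT.
have := @mean_value_le _ (fun z => f z * f z) (fun=> 0) 0 z 0; rewrite mul0r; apply.
by move=> s _ /=; split; [exact: hasD_sub (D0 _)|rewrite modC0].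
Qed.

Variables (f : R[i] -> R[i]) (z0 : R[i]).
Hypotheses (hf : holo f) (f0 : f z0 != 0) (df0 : D1 f z0 != 0).

Let a := f z0.
Let y z := f z - a.
Let Y z := y z ^+ t.
Let kappa := lead_coef P * D1 f z0 ^+ t.
Let cn n := (n * t)`!%:R * kappa ^+ n * a.

Let hy : holo y.
Proof. by move=> z; eexists; apply: hasDB; [exact: holoD1|exact: hasD_cst]. Qed.

Let y0 : y z0 = 0. Proof. by rewrite /y subrr. Qed.

Let dy0 : D1 y z0 = D1 f z0.
Proof.
apply: hasD_D1; rewrite -[X in hasD _ _ _ X]subr0.
by apply: hasDB; [exact: holoD1|exact: hasD_cst].
Qed.

Let t_gt0 : (0 < t)%N. Proof. by rewrite /t -subn1 subn_gt0. Qed.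

Let kappa0 : kappa != 0.
Proof. by rewrite mulf_neq0 ?expf_neq0// lead_coef_eq0 -size_poly_gt0 ltnW. Qed.

Lemma iterT_leading n : iter n (T P) (fun z => f z * Y z ^+ n) z0 = cn n.
Proof.
have [v _ [E v0]] := iterT_powM hy y0 n 0 P1 hf.
have -> : (fun z => f z * Y z ^+ n) = fun z => y z ^+ (0 + n * t) * f z.
  by apply/funext => z; rewrite /Y -exprM add0n mulnC mulrC.
rewrite E expr0 mul1r; move: v0; rewrite fact0 mulr1 => ->.
by rewrite add0n dy0.
Qed.

(** [Y ^+ n.+1] is [y ^ (t + n t)]: the iterates use up [n t] factors, and the remaining [y ^ t] is
    0 at [z0] because [t > 0]. *)
Lemma iterT_tail n u : holo u -> iter n (T P) (fun z => Y z ^+ n.+1 * u z) z0 = 0.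
Proof.
move=> hu; have [v _ [E _]] := iterT_powM hy y0 n t P1 hu.
have -> : (fun z => Y z ^+ n.+1 * u z) = fun z => y z ^+ (t + n * t) * u z.
  by apply/funext => z; rewrite /Y -exprM mulnC mulSn.
by rewrite E y0 expr0n gtn_eqF ?mul0r// t_gt0.
Qed.

(* Keeps [iter n T (p + next_coef n p * (f * Y ^+ n))] of modulus at least 1 at
   [z0]. *)
Definition next_coef n (p : R[i] -> R[i]) : R[i] :=
  if modC (iter n (T P) p z0) < 1 then 2 / cn n else 0.

(** The recursion runs on partial sums rather than on coefficients, since the next coefficient
    depends on the whole sum built so far. *)
Fixpoint partial n : R[i] -> R[i] :=
  if n is m.+1 then fun z => partial m z + next_coef m (partial m) * (f z * Y z ^+ m)
  else fun=> 0.

Definition coef n := next_coef n (partial n).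

Lemma partialE n z : partial n z = f z * psum coef n (Y z).
Proof.
elim: n => [|n IH]; first by rewrite /psum big_ord0 mulr0.
by rewrite /= IH psumS -/(coef n); ring.
Qed.

Lemma cn_neq0 n : cn n != 0.
Proof. by rewrite !mulf_neq0 ?expf_neq0// pnatr_eq0 -lt0n fact_gt0. Qed.

(** The coefficients are 0 or [2 / cn n], and [(n t)! >= n!] because [t >= 1]. *)
Lemma entire_coef_coef : entire_coef coef.
Proof.
have K0 : 0 < modC kappa by rewrite modC_gt0.
have a0 : 0 < modC a by rewrite modC_gt0.
apply: (@entire_coef_factorial _ _ (2 / modC a) (modC kappa)^-1).
- by rewrite invr_ge0 ltW.
- by rewrite divr_ge0// ltW.
move=> n; rewrite /coef /next_coef; case: ifP => _; last first.
  by rewrite modC0 !mulr_ge0 ?invr_ge0 ?exprn_ge0 ?invr_ge0 ?(ltW K0) ?(ltW a0).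
rewrite modCM modCV modC_nat.
have -> : modC (cn n) = (n * t)`!%:R * modC kappa ^+ n * modC a.
  by rewrite [LHS]modCM [modC (_ * _)]modCM modC_nat modCX.
have -> : 2 / ((n * t)`!%:R * modC kappa ^+ n * modC a) =
    2 / modC a * (modC kappa)^-1 ^+ n / (n * t)`!%:R.
  by rewrite exprVn; field; rewrite !gt_eqF ?exprn_gt0 ?ltr0n ?fact_gt0.
rewrite ler_wpM2l ?mulr_ge0 ?exprn_ge0 ?invr_ge0 ?(ltW K0) ?(ltW a0)//.
by rewrite lef_pV2 ?posrE ?ltr0n ?fact_gt0// ler_nat leq_fact// leq_pmulr.
Qed.

Lemma exists_escaping_series : exists b G, [/\ entire_coef b, holo G,
  (forall r : R, exists C : R, forall n z, modC z <= r ->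
    modC (G z - psum b n z) <= C / 2 ^+ n) &
  forall n, 1 <= modC (iter n (T P) (fun z => f z * G (Y z)) z0)].
Proof.
have ec := entire_coef_coef.
have [G GP] := pseries_limit ec.
have hG : holo G := pseries_entire ec GP.
have hY : holo Y := holoX _ hy.
have hpart n : holo (partial n).
  elim: n => [|n IH] /=; first exact: holo_cst.
  by apply: holoD => //; apply: holoZ; apply: holoM => //; exact: holoX.
exists coef, G; split=> // n.
have ecn := entire_coef_shift n.+1 ec.
have [GN GNP] := pseries_limit ecn.
have hGN : holo GN := pseries_entire ecn GNP.
(* The tail beyond [n], the n-th term and the partial sum; the factor 1 fits the shape of
   [iterT_lin]. *)
have -> : (fun z => f z * G (Y z)) = fun z => 1 * (Y z ^+ n.+1 * (f z * GN (Y z))) +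
   (coef n * (f z * Y z ^+ n) + partial n z).
  apply/funext => z; rewrite (pseries_tail ec GP GNP) psumS partialE; ring.
have hu : holo (fun z => f z * GN (Y z)) by apply: holoM => //; exact: holo_comp.
have hm : holo (fun z => f z * Y z ^+ n) by apply: holoM => //; exact: holoX.
rewrite iterT_lin; [|by apply: holoM => //; exact: holoX|by apply: holoD => //; exact: holoZ].
rewrite iterT_tail// mulr0 add0r iterT_lin// iterT_leading /coef /next_coef.
(* Either the partial sum already reaches modulus 1 and the coefficient is 0, or it stays below 1
   and the n-th term contributes exactly 2. *)
case: ltP => [lt1|]; last by rewrite mul0r add0r.
rewrite divfK ?cn_neq0//; set x := iter _ _ _ _ in lt1 *.
by have := ler_modCB (2 + x) x; rewrite addrK modC_nat; lra.
Qed.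

End Main.

Theorem proposition6p1 (R : realType) (P : {poly R[i]}) (hP : (1 < size P)%N) :
  ~ admits_closed_hypercyclic_algebra (poly_D P).
Proof.
move=> [A [[A0 AD AZ AM] [F [cF AF]] An0 AHC]].
have Aholo f : A f -> holo f by rewrite AF => -[/entireP].
have [f [Af fn0]] : exists f, A f /\ f <> (fun=> 0).
  apply: contrapT => H; apply: An0; apply/seteqP; split=> [f Af|f ->]//=.
  by apply: contrapT => fn0; apply: H; exists f.
have [|z0 [fz0 dfz0]] := nonconstant_point (Aholo f Af).
  (* [f * f] is in the algebra; if constant, it is not hypercyclic, so it is 0, and then [f = 0]. *)
  move=> c fc; have := AHC _ (AM _ _ Af Af); rewrite fc => -[/cst_not_HC//|/= c0].
  apply: fn0; apply/funext => z.
  have fz : f z * f z = c by exact: (congr1 (fun g : R[i] -> R[i] => g z) fc).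
  have cz : c = 0 by exact: (congr1 (fun g : R[i] -> R[i] => g z) c0).
  by move: fz; rewrite cz => /eqP; rewrite mulf_eq0 orbb => /eqP.
have [b [G [eb hG GP escG]]] := exists_escaping_series hP (Aholo f Af) fz0 dfz0.
pose Y (z : R[i]) : R[i] := (f z - f z0) ^+ (size P).-1.
pose h (z : R[i]) : R[i] := f z * G (Y z).
have {}escG n : 1 <= modC (iter n (poly_D P) h z0) := escG n.
have hY : holo Y.
  apply: holoX => z; eexists; apply: hasDB; [exact: holoD1 (Aholo f Af)|exact: hasD_cst].
(* The factor [f] replaces the missing unit: multiplying by [f - a] means multiplying by [f] and
   subtracting a scalar multiple. *)
have Apow k : A (fun z => f z * (f z - f z0) ^+ k).
  elim: k => [|k IH]; first by under eq_fun do rewrite expr0 mulr1.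
  have := AD _ _ (AM _ _ IH Af) (AZ (- f z0) _ IH); congr A.
  by apply/funext => z; rewrite exprS; ring.
have Ah : A h.
  rewrite AF; split.
    by apply/entireP; apply: holoM; [exact: Aholo|exact: holo_comp].
  (* [A] is closed only relative to the entire functions: the limit is placed in [F], its being
     entire was shown separately. *)
  apply: (closed_pseries cF (Aholo f Af) hY GP) => n.
  suff : A (fun z => f z * psum b n (Y z)) by rewrite AF => -[].
  elim: n => [|n IH].
    by move: A0; congr A; apply/funext => z; rewrite /psum big_ord0 mulr0.
  have := AD _ _ IH (AZ (b n) _ (Apow ((size P).-1 * n)%N)); congr A.
  by apply/funext => z; rewrite psumS /Y -exprM; ring.
have h01 : 0 < 1 :> R := ltr01.
case: (AHC _ Ah) => [[_ dense]|/= h0].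
  have zero_entire : @entire R (fun=> 0) by apply/entireP; exact: holo_cst.
  have [_ [[n _ <-]]] := dense _ zero_entire _ (@nbhs_eval R (fun=> 0) z0 _ h01).
  by rewrite /= subr0 ltNge escG.
(* The bound for [n = 0] says that [h] itself is not the zero function. *)
have := escG 0%N; rewrite /= -/h h0 modC0 => le10.
by move: h01; rewrite ltNge le10.
Qed.
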